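(* Let $n\ge 3$. There exist two distinct elements of $B_n(S^2)$ which are not distinguished by any Vassiliev invariant with values in an abelian group without 2-torsion. For any two elements $a\neq b$ of $B_n(S^2)$ there exist a natural number $k$ and a Vassiliev invariant $v$ with values in an abelian group $A$ having an element of order $2^k$ such that $v$ distinguishes $a$ and $b$: $v(a)\ne v(b)$.
   Context: $B_n(S^2)$ is the braid group of the 2-sphere on $n$ strands, generated by $\sigma_1,\dots,\sigma_{n-1}$ with the braid relations ($\sigma_i\sigma_j=\sigma_j\sigma_i$ for $|i-j|>1$, $\sigma_i\sigma_{i+1}\sigma_i=\sigma_{i+1}\sigma_i\sigma_{i+1}$) and $\sigma_1\cdots\sigma_{n-2}\sigma_{n-1}^2\sigma_{n-2}\cdots\sigma_1=1$. Let $W$ be the two-sided ideal of $\mathbb Z[B_n(S^2)]$ generated by the elements $\sigma_i-\sigma_i^{-1}$, $1\le i\le n-1$, and $\Phi^m=W^m$. For an abelian group $A$, a map of sets $v:B_n(S^2)\to A$, extended additively to $\mathbb Z[B_n(S^2)]\to A$, is a Vassiliev invariant of degree $m$ if it vanishes on $\Phi^{m+1}$; a Vassiliev invariant is a map which is of degree $m$ for some $m\ge0$. *)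

(* Defs.v *)
From HB Require Import structures.
From mathcomp Require Import all_boot all_order all_algebra.
From mathcomp Require Import finmap monalg.
From mathcomp Require Import boolp classical_sets.

Set Implicit Arguments.
Unset Strict Implicit.
Unset Printing Implicit Defensive.

Import GRing.Theory.

Local Open Scope quotient_scope.
Local Open Scope ring_scope.

(* The letter (x, false) stands for the generator x, (x, true) for x^-1. *)
Definition word (X : Type) : Type := seq (X * bool).

Definition gen_word (X : Type) (s : seq X) : word X :=
  [seq (x, false) | x <- s].

Definition inv_letter (X : Type) (l : X * bool) : X * bool := (l.1, ~~ l.2).

Definition inv_word (X : Type) (w : word X) : word X :=
  rev (map (@inv_letter X) w).

(* The least congruence on words identifying both x x^-1 and x^-1 x with the
   empty word, and the two sides of every relation in [rel]. *)
Inductive word_eq (X : Type) (rel : word X -> word X -> Prop) :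
    word X -> word X -> Prop :=
| word_eq_refl u : word_eq rel u u
| word_eq_sym u v : word_eq rel u v -> word_eq rel v u
| word_eq_trans u v w : word_eq rel u v -> word_eq rel v w -> word_eq rel u w
| word_eq_cat u u' v v' :
    word_eq rel u u' -> word_eq rel v v' -> word_eq rel (u ++ v) (u' ++ v')
| word_eq_cancel l : word_eq rel [:: l; inv_letter l] [::]
| word_eq_rel u v : rel u v -> word_eq rel u v.

Section PresentedGroup.
Variables (X : choiceType) (rel : word X -> word X -> Prop).

Definition word_eqb (u v : seq (X * bool)) : bool := `[< word_eq rel u v >].

Lemma word_eqb_refl : reflexive word_eqb.
Proof. by move=> u; apply/asboolP; exact: word_eq_refl. Qed.

Lemma word_eqb_sym : symmetric word_eqb.
Proof. by move=> u v; apply/asboolP/asboolP; exact: word_eq_sym. Qed.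

Lemma word_eqb_trans : transitive word_eqb.
Proof.
by move=> v u w /asboolP uv /asboolP vw; apply/asboolP; exact: word_eq_trans vw.
Qed.

Canonical word_equiv :=
  EquivRel word_eqb word_eqb_refl word_eqb_sym word_eqb_trans.

Definition presented_group : Type := {eq_quot word_equiv}.

HB.instance Definition _ := Choice.on presented_group.
HB.instance Definition _ := EqQuotient.on presented_group.

Definition pg_class (w : word X) : presented_group := \pi w.

Lemma pg_classP u v : pg_class u = pg_class v <-> word_eq rel u v.
Proof. by split=> [/eqquotP/asboolP|h] //; apply/eqquotP/asboolP. Qed.

Lemma pg_classK a : pg_class (repr a) = a.
Proof. exact: reprK. Qed.

Definition pg_one : presented_group := pg_class [::].
Definition pg_mul (a b : presented_group) : presented_group :=
  pg_class (repr a ++ repr b).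
Definition pg_inv (a : presented_group) : presented_group :=
  pg_class (inv_word (repr a)).

Lemma inv_letterK : involutive (@inv_letter X).
Proof. by case=> x b; rewrite /inv_letter /= negbK. Qed.

Lemma inv_wordK : involutive (@inv_word X).
Proof.
move=> w; rewrite /inv_word map_rev revK -map_comp map_id_in // => l _.
exact: inv_letterK.
Qed.

Lemma word_eq_catV (w : word X) : word_eq rel (w ++ inv_word w) [::].
Proof.
elim: w => [|l w IHw]; first exact: word_eq_refl.
rewrite /inv_word map_cons rev_cons -cats1 -/(inv_word w) catA.
apply: word_eq_trans (word_eq_cancel rel l).
apply: (@word_eq_cat _ _ (l :: (w ++ inv_word w)) [:: l]); last first.
  exact: word_eq_refl.
apply: (@word_eq_cat _ _ [:: l] [:: l] _ [::]) => //; exact: word_eq_refl.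
Qed.

Lemma word_eq_Vcat (w : word X) : word_eq rel (inv_word w ++ w) [::].
Proof. by rewrite -{2}(inv_wordK w); exact: word_eq_catV. Qed.

Lemma pg_mulE u v : pg_mul (pg_class u) (pg_class v) = pg_class (u ++ v).
Proof. by apply/pg_classP/word_eq_cat; apply/pg_classP; rewrite pg_classK. Qed.

Lemma pg_mulA : associative pg_mul.
Proof.
move=> a b c; rewrite -(pg_classK a) -(pg_classK b) -(pg_classK c).
by rewrite !pg_mulE catA.
Qed.

Lemma pg_mul1g : left_id pg_one pg_mul.
Proof. by move=> a; rewrite -(pg_classK a) pg_mulE. Qed.

Lemma pg_mulg1 : right_id pg_one pg_mul.
Proof. by move=> a; rewrite -(pg_classK a) pg_mulE cats0. Qed.

Lemma pg_mulVg : left_inverse pg_one pg_inv pg_mul.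
Proof.
move=> a; rewrite -{2}(pg_classK a) pg_mulE.
by apply/pg_classP; exact: word_eq_Vcat.
Qed.

Lemma pg_mulgV : right_inverse pg_one pg_inv pg_mul.
Proof.
move=> a; rewrite -{1}(pg_classK a) pg_mulE.
by apply/pg_classP; exact: word_eq_catV.
Qed.

HB.instance Definition _ := isGroup.Build presented_group
  pg_mulA pg_mul1g pg_mulg1 pg_mulVg pg_mulgV.

End PresentedGroup.

(* The index i : 'I_n.-1 stands for the generator numbered i + 1, so that
   [enum 'I_n.-1] is the list of all the generators in increasing order. *)
Inductive sphere_braid_rel (n : nat) :
    word 'I_n.-1 -> word 'I_n.-1 -> Prop :=
| braid_far (i j : 'I_n.-1) : (i.+1 < j)%N || (j.+1 < i)%N ->
    sphere_braid_rel (gen_word [:: i; j]) (gen_word [:: j; i])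
| braid_near (i j : 'I_n.-1) : j = i.+1 :> nat ->
    sphere_braid_rel (gen_word [:: i; j; i]) (gen_word [:: j; i; j])
| braid_sphere :
    sphere_braid_rel (gen_word (enum 'I_n.-1 ++ rev (enum 'I_n.-1))) [::].

Definition sphere_braid_group (n : nat) : groupType :=
  presented_group (@sphere_braid_rel n).

Definition sphere_sigma (n : nat) (i : 'I_n.-1) : sphere_braid_group n :=
  pg_class _ [:: (i, false)].

(* The library ring structure on [{malg int[K]}] requires [K] to be a monoid
   in which a product is 1 only if both factors are, hence this copy. *)
Definition group_ring (G : groupType) : Type := {malg int[G]}.

HB.instance Definition _ (G : groupType) := GRing.Zmodule.on (group_ring G).

Section GroupRing.
Variable G : groupType.

Definition gr_elt (g : G) : group_ring G := << 1 *g g >>.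

Local Notation gr_monom c g := (<< c *g g >> : group_ring G).

Definition gr_mul (x y : group_ring G) : group_ring G :=
  \sum_(g <- msupp x) \sum_(h <- msupp y) gr_monom (x@_g * y@_h) (g * h)%g.

Lemma gr_mulw (d1 d2 : {fset G}) (x y : group_ring G) :
  (msupp x `<=` d1)%fset -> (msupp y `<=` d2)%fset ->
  gr_mul x y =
    \sum_(g <- d1) \sum_(h <- d2) gr_monom (x@_g * y@_h) (g * h)%g.
Proof.
move=> le_d1 le_d2; rewrite /gr_mul (big_fset_incl _ le_d1) /=.
  apply/eq_bigr=> g _; apply/big_fset_incl => // h _ /mcoeff_outdom ->.
  by rewrite mulr0 monalgU0.
move=> g _ /mcoeff_outdom xg.
by rewrite big1 => // h _; rewrite xg mul0r monalgU0.
Qed.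

Lemma gr_mulDl : left_distributive gr_mul +%R.
Proof.
move=> x y z; rewrite (gr_mulw (msuppD_le x y) (fsubset_refl (msupp z))).
rewrite (gr_mulw (fsubsetUl (msupp x) (msupp y)) (fsubset_refl (msupp z))).
rewrite (gr_mulw (fsubsetUr (msupp x) (msupp y)) (fsubset_refl (msupp z))).
rewrite -big_split /=; apply/eq_bigr=> g _.
rewrite -big_split /=; apply/eq_bigr=> h _.
by rewrite mcoeffD mulrDl monalgUD.
Qed.

Lemma gr_mulDr : right_distributive gr_mul +%R.
Proof.
move=> z x y; rewrite (gr_mulw (fsubset_refl (msupp z)) (msuppD_le x y)).
rewrite (gr_mulw (fsubset_refl (msupp z)) (fsubsetUl (msupp x) (msupp y))).
rewrite (gr_mulw (fsubset_refl (msupp z)) (fsubsetUr (msupp x) (msupp y))).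
rewrite -big_split /=; apply/eq_bigr=> g _.
rewrite -big_split /=; apply/eq_bigr=> h _.
by rewrite mcoeffD mulrDr monalgUD.
Qed.

Lemma gr_mul0 : left_zero 0 gr_mul.
Proof. by move=> x; rewrite /gr_mul msupp0 big_seq_fset0. Qed.

Lemma gr_mulr0 : right_zero 0 gr_mul.
Proof.
by move=> x; rewrite /gr_mul big1 // => g _; rewrite msupp0 big_seq_fset0.
Qed.

Lemma gr_mulUU c d g h :
  gr_mul (gr_monom c g) (gr_monom d h) = gr_monom (c * d) (g * h)%g.
Proof. by rewrite (gr_mulw msuppU_le msuppU_le) !big_seq_fset1 !mcoeffUU. Qed.

Lemma gr_ind (P : group_ring G -> Prop) :
  P 0 -> (forall x y, P x -> P y -> P (x + y)) ->
  (forall c g, P (gr_monom c g)) -> forall x, P x.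
Proof.
move=> P0 PD PU x; rewrite (monalgE x).
by elim/big_rec: _ => // g y _ Py; apply: PD.
Qed.

Lemma gr_mulA : associative gr_mul.
Proof.
move=> x y z; elim/gr_ind: x => [|x x' IHx IHx'|c g]; first by rewrite !gr_mul0.
  by rewrite !gr_mulDl IHx IHx'.
elim/gr_ind: y => [|y y' IHy IHy'|d h].
- by rewrite gr_mul0 gr_mulr0 gr_mul0.
- by rewrite gr_mulDl !gr_mulDr gr_mulDl IHy IHy'.
elim/gr_ind: z => [|z z' IHz IHz'|e k]; first by rewrite !gr_mulr0.
  by rewrite !gr_mulDr IHz IHz'.
by rewrite !gr_mulUU mulrA mulgA.
Qed.

Lemma gr_mul1l : left_id (gr_elt 1%g) gr_mul.
Proof.
elim/gr_ind => [|x y IHx IHy|c g]; first exact: gr_mulr0.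
  by rewrite gr_mulDr IHx IHy.
by rewrite gr_mulUU mul1r mul1g.
Qed.

Lemma gr_mul1r : right_id (gr_elt 1%g) gr_mul.
Proof.
elim/gr_ind => [|x y IHx IHy|c g]; first exact: gr_mul0.
  by rewrite gr_mulDl IHx IHy.
by rewrite gr_mulUU mulr1 mulg1.
Qed.

Lemma gr_oner_neq0 : gr_elt 1%g != 0.
Proof. by rewrite monalgU_eq0. Qed.

HB.instance Definition _ := GRing.Zmodule_isNzRing.Build (group_ring G)
  gr_mulA gr_mul1l gr_mul1r gr_mulDl gr_mulDr gr_oner_neq0.

Definition gr_extend (A : zmodType) (v : G -> A) (x : group_ring G) : A :=
  \sum_(g <- msupp x) v g *~ x@_g.

End GroupRing.

Local Open Scope classical_set_scope.

Section TwoSidedIdeals.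
Variable R : nzRingType.

Definition additive_subgroup (I : set R) : Prop :=
  I 0 /\ forall x y, I x -> I y -> I (x - y).

Definition two_sided_ideal (I : set R) : Prop :=
  additive_subgroup I /\ forall a x, I x -> I (a * x) /\ I (x * a).

Definition ideal_gen (X : set R) : set R := smallest two_sided_ideal X.

Definition ideal_mul (I J : set R) : set R :=
  smallest additive_subgroup [set z | exists2 x, I x & exists2 y, J y & z = x * y].

Fixpoint ideal_pow (I : set R) (m : nat) : set R :=
  if m is m'.+1 then ideal_mul (ideal_pow I m') I else setT.

End TwoSidedIdeals.

Definition singular_ideal (n : nat) : set (group_ring (sphere_braid_group n)) :=
  ideal_gen [set w | exists i : 'I_n.-1,
    w = gr_elt (sphere_sigma i) - gr_elt (sphere_sigma i)^-1%g].
Arguments singular_ideal : clear implicits.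

Definition vassiliev_filtration (n m : nat) :
    set (group_ring (sphere_braid_group n)) :=
  ideal_pow (singular_ideal n) m.
Arguments vassiliev_filtration : clear implicits.

Definition vassiliev_of_degree (n : nat) (A : zmodType)
    (v : sphere_braid_group n -> A) (m : nat) : Prop :=
  forall x, vassiliev_filtration n m.+1 x -> gr_extend v x = 0.

Definition vassiliev_invariant (n : nat) (A : zmodType)
    (v : sphere_braid_group n -> A) : Prop :=
  exists m : nat, vassiliev_of_degree v m.

Definition no_2_torsion (A : zmodType) : Prop :=
  forall x : A, x *+ 2 = 0 -> x = 0.

Definition has_additive_order (A : zmodType) (x : A) (d : nat) : Prop :=
  [/\ (0 < d)%N, x *+ d = 0 & forall e, (0 < e)%N -> x *+ e = 0 -> (d <= e)%N].

(* Main.v *)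
From HB Require Import structures.
Require Import Defs.
From mathcomp Require Import all_boot all_algebra.
From mathcomp Require Import finmap monalg.
From mathcomp Require Import boolp classical_sets.
From mathcomp Require Import zify.

(* Write W for the singular ideal.  A Vassiliev invariant separates a from b as
   soon as a b^-1 - 1 lies outside some W^m (take values in Z[B_n] / W^(m+1),
   times Z/2), so the second half says that g = 1 whenever g - 1 lies in every
   W^m; call such a g undetected.  The proof is by induction on n.  An
   undetected g fixes the last position, and forgetting the last strand maps it
   to an undetected element of B_(n-1), hence to 1; rewriting in the
   presentation shows that g is then a word u in the loops A_1, ..., A_(n-1) of
   the last strand around the others, with A_1 ... A_(n-1) = 1.  The stabiliser of the last position acts by the
   Hurwitz moves on tuples (y_1, ..., y_(n-1)) of product 1 in a group, and A_j
   acts by conjugation by y_j.  With y_i mapped to unitriangular matrices,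
   sigma_i - sigma_i^-1 raises the augmentation degree of functions of the
   tuple, so undetected elements act trivially: u(y) is central.  When n >= 4
   the group generated by the y_i can be taken free of rank n - 2 >= 2, and
   Magnus' unitriangular matrices show that u is trivial.  For n = 3 the loops
   generate a group of order 2, detected by B_3(S^2) -> Z/4.
   The full twist t satisfies t <> 1, t^2 = 1 and t - 1 in W, whence
   2^m (t - 1) = +- (t - 1)^(m+1) lies in W^(m+1): without 2-torsion no
   Vassiliev invariant separates t from 1. *)

Set Implicit Arguments.
Unset Strict Implicit.
Unset Printing Implicit Defensive.

Import GRing.Theory.
Local Open Scope ring_scope.

(** * Integral group rings and powers of ideals *)

Section GroupRingExtension.
Variable G : groupType.

Lemma gr_extendEw (A : zmodType) (v : G -> A) (d : {fset G})
    (x : group_ring G) :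
  (msupp x `<=` d)%fset -> gr_extend v x = \sum_(g <- d) v g *~ x@_g.
Proof.
move=> le_d; rewrite /gr_extend (big_fset_incl _ le_d) // => g _.
by move/mcoeff_outdom->; rewrite mulr0z.
Qed.

Lemma gr_extendD (A : zmodType) (v : G -> A) :
  {morph gr_extend v : x y / x + y}.
Proof.
move=> x y; rewrite (gr_extendEw v (msuppD_le x y)).
rewrite (gr_extendEw v (fsubsetUl (msupp x) (msupp y))).
rewrite (gr_extendEw v (fsubsetUr (msupp x) (msupp y))) -big_split /=.
by apply: eq_bigr => g _; rewrite mcoeffD mulrzDr.
Qed.

Lemma gr_extend0 (A : zmodType) (v : G -> A) : gr_extend v 0 = 0.
Proof. by apply: (addIr (gr_extend v 0)); rewrite -gr_extendD !add0r. Qed.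

Lemma gr_extendB (A : zmodType) (v : G -> A) :
  {morph gr_extend v : x y / x - y}.
Proof.
by move=> x y; apply: (addIr (gr_extend v y)); rewrite -gr_extendD !subrK.
Qed.

Lemma gr_extendU (A : zmodType) (v : G -> A) c g :
  gr_extend v (<< c *g g >> : group_ring G) = v g *~ c.
Proof. by rewrite (gr_extendEw v msuppU_le) big_seq_fset1 mcoeffUU. Qed.

Lemma gr_extend_elt (A : zmodType) (v : G -> A) g :
  gr_extend v (gr_elt g) = v g.
Proof. by rewrite gr_extendU. Qed.

Lemma gr_eltM (g h : G) : gr_elt (g * h)%g = gr_elt g * gr_elt h.
Proof. by rewrite /GRing.mul /= gr_mulUU. Qed.

Lemma gr_elt1 : gr_elt (1 : G)%g = 1.
Proof. by []. Qed.

Lemma gr_extendM (A : zmodType) (v : G -> A) x y :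
  gr_extend v (x * y) =
  gr_extend (fun g => gr_extend (fun h => v (g * h)%g) y) x.
Proof.
elim/gr_ind: x => [|x x' IHx IHx'|c g].
- by rewrite mul0r !gr_extend0.
- by rewrite mulrDl !gr_extendD IHx IHx'.
rewrite gr_extendU; elim/gr_ind: y => [|y y' IHy IHy'|d h].
- by rewrite mulr0 !gr_extend0 mul0rz.
- by rewrite mulrDr !gr_extendD IHy IHy' mulrzDl.
have -> : (<< c *g g >> : group_ring G) * << d *g h >> = << c * d *g (g * h)%g >>.
  exact: gr_mulUU.
by rewrite !gr_extendU mulrC mulrzA.
Qed.

Lemma gr_extend_additive (A B : zmodType) (v : G -> A) (f : A -> B) x :
  {morph f : a b / a - b} -> f (gr_extend v x) = gr_extend (f \o v) x.
Proof.
move=> fB; have f0 : f 0 = 0 by rewrite -{1}(subrr 0) fB subrr.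
have fN a : f (- a) = - f a by rewrite -sub0r fB f0 sub0r.
have fD a b : f (a + b) = f a + f b by rewrite -{1}(opprK b) fB fN opprK.
have fMn a k : f (a *+ k) = f a *+ k.
  by elim: k => [|k IHk]; rewrite ?mulr0n // !mulrS fD IHk.
elim/gr_ind: x => [|x x' IHx IHx'|c g]; first by rewrite !gr_extend0.
  by rewrite !gr_extendD fD IHx IHx'.
rewrite !gr_extendU /=; case: c => k; first by rewrite -!pmulrn.
by rewrite !NegzE !mulrNz -!pmulrn fN fMn.
Qed.

End GroupRingExtension.

Local Open Scope classical_set_scope.

Section IdealPowers.
Variable R : nzRingType.
Implicit Types (I J : set R) (x y : R).

Lemma additive_subgroupN I x : additive_subgroup I -> I x -> I (- x).
Proof. by case=> I0 IB Ix; rewrite -sub0r; apply: IB. Qed.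

Lemma additive_subgroupD I x y :
  additive_subgroup I -> I x -> I y -> I (x + y).
Proof.
by move=> HI Ix Iy; rewrite -(opprK y); apply: HI.2 => //; apply: additive_subgroupN.
Qed.

Lemma smallest_additive X :
  additive_subgroup (smallest (@additive_subgroup R) X).
Proof.
split=> [J [[J0 _] _]|x y Hx Hy J HJ] //.
by apply: HJ.1.2; [exact: Hx|exact: Hy].
Qed.

Lemma ideal_gen_ideal X : two_sided_ideal (@ideal_gen R X).
Proof.
split; first split=> [J [[[J0 _] _] _]|x y Hx Hy J HJ] //.
  by apply: HJ.1.1.2; [exact: Hx|exact: Hy].
by move=> a x Hx; split=> J HJ; have [] := HJ.1.2 a x (Hx J HJ).
Qed.

Lemma mem_ideal_mul I J x y : I x -> J y -> ideal_mul I J (x * y).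
Proof. by move=> Ix Jy K [_]; apply; exists x => //; exists y. Qed.

Lemma ideal_mul_ind I J (K : R -> Prop) :
  additive_subgroup K -> (forall x y, I x -> J y -> K (x * y)) ->
  forall z, ideal_mul I J z -> K z.
Proof.
by move=> HK IJ z; apply; split=> // _ [x Ix [y Jy ->]]; apply: IJ.
Qed.

Lemma ideal_pow_ideal I m :
  two_sided_ideal I -> two_sided_ideal (ideal_pow I m).
Proof.
move=> HI; elim: m => [|m IHm] /=; first by split.
split; first exact: smallest_additive.
have [M0 MB] : additive_subgroup (ideal_mul (ideal_pow I m) I).
  exact: smallest_additive.
move=> a; apply: ideal_mul_ind => [|x y Ix Iy].
  split; first by rewrite /= mulr0 mul0r.
  by move=> x y [ax xa] [ay ya]; rewrite /= mulrBr mulrBl; split; apply: MB.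
split; rewrite /= ?mulrA -?(mulrA x).
  by apply: mem_ideal_mul => //; have [] := IHm.2 a x Ix.
by apply: mem_ideal_mul => //; have [] := HI.2 a y Iy.
Qed.

(** Powers are built by adding factors on the right; associativity lets a factor enter on the left
    as well. This is the form needed for functions [x |-> x * z], where a change of [x] becomes a
    left factor of [z]. *)
Lemma ideal_pow_mull I m x y :
  two_sided_ideal I -> I x -> ideal_pow I m y -> ideal_pow I m.+1 (x * y).
Proof.
move=> HI Ix; elim: m y => [|m IHm] /=.
  by move=> y _; rewrite -(mul1r (x * y)); apply: mem_ideal_mul => //;
     have [] := HI.2 y x Ix.
apply: ideal_mul_ind => [|y z Iy Iz].
  have [M0 MB] : additive_subgroup (ideal_pow I m.+2).
    exact: (ideal_pow_ideal m.+2 HI).1.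
  by split=> [|y z Hy Hz] /=; rewrite ?mulr0 // mulrBr; apply: MB.
by rewrite /= mulrA; apply: mem_ideal_mul => //; exact: IHm.
Qed.

Lemma ideal_pow_le I m k x :
  two_sided_ideal I -> (k <= m)%N -> ideal_pow I m x -> ideal_pow I k x.
Proof.
move=> HI /subnK <-; elim: (m - k)%N x => [|d IHd] x //.
rewrite addSn => Hx; apply: IHd; move: x Hx.
apply: ideal_mul_ind; first exact: (ideal_pow_ideal _ HI).1.
by move=> x y Hx _; have [] := (ideal_pow_ideal (d + k) HI).2 y x Hx.
Qed.

End IdealPowers.

(** * Actions of presented groups *)

Section WordAction.
Variables (C : Type) (X : Type) (f f' : C -> X -> X).

Definition word_act (w : word C) (x : X) : X :=
  foldl (fun y l => if l.2 then f' l.1 y else f l.1 y) x w.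

Lemma word_act_cat u v x : word_act (u ++ v) x = word_act v (word_act u x).
Proof. exact: foldl_cat. Qed.

Lemma word_act_gen s x :
  word_act (gen_word s) x = foldl (fun y c => f c y) x s.
Proof. by rewrite /word_act /gen_word; elim: s x => //= c s IHs x. Qed.

Hypotheses (fK : forall c, cancel (f c) (f' c)).
Hypotheses (f'K : forall c, cancel (f' c) (f c)).

Lemma word_act_eq (rel : word C -> word C -> Prop) :
  (forall u v, rel u v -> word_act u =1 word_act v) ->
  forall u v, word_eq rel u v -> word_act u =1 word_act v.
Proof.
move=> Hrel u v; elim=> {u v} [u|u v _ IH|u v w _ IH1 _ IH2|u u' v v' _ IH1 _ IH2|l|u v /Hrel] // x.
- by rewrite IH1 IH2.
- by rewrite !word_act_cat IH1 IH2.
- by case: l => c [] /=; rewrite ?fK ?f'K.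
Qed.

End WordAction.

Section PresentedGroupAction.
Variables (C : choiceType) (rel : word C -> word C -> Prop).
Variables (X : Type) (f f' : C -> X -> X).

(** A right action, computed on a chosen representative; [pg_actE] removes that choice once the
    generators act invertibly and respect the relations. *)
Definition pg_act (g : presented_group rel) : X -> X := word_act f f' (repr g).

Hypotheses (fK : forall c, cancel (f c) (f' c)).
Hypotheses (f'K : forall c, cancel (f' c) (f c)).
Hypothesis frel : forall u v, rel u v -> word_act f f' u =1 word_act f f' v.

Lemma pg_actE u x : pg_act (pg_class rel u) x = word_act f f' u x.
Proof.
by apply: (word_act_eq fK f'K frel); apply/pg_classP; rewrite pg_classK.
Qed.

Lemma pg_act1 x : pg_act 1%g x = x.
Proof. exact: pg_actE. Qed.

Lemma pg_actM g h x : pg_act (g * h)%g x = pg_act h (pg_act g x).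
Proof. by rewrite pg_actE word_act_cat. Qed.

Lemma pg_classM u v : pg_class rel (u ++ v) = (pg_class rel u * pg_class rel v)%g.
Proof. by symmetry; apply: pg_mulE. Qed.

Lemma pg_act_gen c x : pg_act (pg_class rel [:: (c, false)]) x = f c x.
Proof. exact: pg_actE. Qed.

Lemma pg_class_inv u : (pg_class rel u)^-1%g = pg_class rel (inv_word u).
Proof.
apply/mulg1_eq; rewrite -pg_classM; apply/pg_classP; exact: word_eq_catV.
Qed.

Lemma pg_act_genV c x : pg_act (pg_class rel [:: (c, false)])^-1%g x = f' c x.
Proof. by rewrite pg_class_inv pg_actE. Qed.

Section FunctionModule.
Variable A : zmodType.

(* The right action on X makes the functions X -> A a left module over the
   group ring. *)
Definition gr_act (w : group_ring (presented_group rel)) (h : X -> A) : X -> A :=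
  fun x => gr_extend (fun g => h (pg_act g x)) w.

Lemma gr_actM a w h : gr_act (a * w) h = gr_act a (gr_act w h).
Proof.
apply/funext => x; rewrite /gr_act gr_extendM; congr gr_extend.
apply/funext => g; congr gr_extend; apply/funext => k.
by rewrite pg_actM.
Qed.

Lemma gr_act_elt g h : gr_act (gr_elt g) h = h \o pg_act g.
Proof. by apply/funext => x; rewrite /gr_act gr_extend_elt. Qed.

Lemma gr_actB a w h : gr_act (a - w) h = fun x => gr_act a h x - gr_act w h x.
Proof. by apply/funext => x; rewrite /gr_act gr_extendB. Qed.

(** [E k h] is read: [h] has degree at least [k]. Each step is a subgroup of functions stable under
    the generators and their inverses, hence a submodule over the group ring. *)
Variable E : nat -> (X -> A) -> Prop.
Hypothesis E0 : forall k, E k (fun=> 0).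
Hypothesis EB : forall k h h', E k h -> E k h' -> E k (fun x => h x - h' x).
Hypothesis Ef : forall k h c, E k h -> E k (h \o f c).
Hypothesis Ef' : forall k h c, E k h -> E k (h \o f' c).

Lemma filtration_word_act k h u : E k h -> E k (h \o word_act f f' u).
Proof.
elim/last_ind: u h => [|u [c b] IHu] h Eh //.
have -> : h \o word_act f f' (rcons u (c, b)) =
          (h \o if b then f' c else f c) \o word_act f f' u.
  apply/funext=> x; rewrite /= -cats1 word_act_cat /=.
  by case: b.
by apply: IHu; case: b; [apply: Ef'|apply: Ef].
Qed.

Lemma filtrationD k h h' : E k h -> E k h' -> E k (fun x => h x + h' x).
Proof.
move=> Eh Eh'; have /(_ _ Eh) := EB _ (EB (E0 k) Eh').
by congr E; apply/funext => x; rewrite sub0r opprK.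
Qed.

Lemma filtration_gr_act k h w : E k h -> E k (gr_act w h).
Proof.
move=> Eh; elim/gr_ind: w => [|w w' IHw IHw'|c g].
- by have := E0 k; congr E; apply/funext => x; rewrite /gr_act gr_extend0.
- have := filtrationD IHw IHw'; congr E.
  by apply/funext => x; rewrite /gr_act gr_extendD.
have Eg : E k (h \o pg_act g) by apply: filtration_word_act.
have EM j : E k (fun x => h (pg_act g x) *+ j).
  elim: j => [|j IHj]; first by have := E0 k; congr E; apply/funext => x.
  have := filtrationD Eg IHj; congr E.
  by apply/funext => x; rewrite mulrS.
case: c => j; first by have := EM j; congr E; apply/funext => x; rewrite /gr_act gr_extendU.
have := EB (E0 k) (EM j.+1); congr E.
by apply/funext => x; rewrite /gr_act gr_extendU NegzE mulrNz sub0r.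
Qed.

End FunctionModule.
End PresentedGroupAction.

Section SphereFiltration.
Variables (n : nat) (X : Type) (f f' : 'I_n.-1 -> X -> X).
Local Notation act := (@pg_act _ (@sphere_braid_rel n) X f f').
Hypotheses (fK : forall c, cancel (f c) (f' c)).
Hypotheses (f'K : forall c, cancel (f' c) (f c)).
Hypothesis frel : forall u v, sphere_braid_rel u v ->
  word_act f f' u =1 word_act f f' v.
Variables (A : zmodType) (E : nat -> (X -> A) -> Prop).
Hypothesis E0 : forall k, E k (fun=> 0).
Hypothesis EB : forall k h h', E k h -> E k h' -> E k (fun x => h x - h' x).
Hypothesis Ef : forall k h c, E k h -> E k (h \o f c).
Hypothesis Ef' : forall k h c, E k h -> E k (h \o f' c).
Hypothesis Ed : forall k h c, E k h -> E k.+1 (fun x => h (f c x) - h (f' c x)).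

(** The elements of the group ring that raise every degree by one form a two-sided ideal, because
    each step is a submodule. By [Ed] this ideal contains the generators of W, and W is the smallest
    such ideal. *)
Lemma singular_ideal_filtration w k h :
  singular_ideal n w -> E k h -> E k.+1 (gr_act f f' w h).
Proof.
move=> Hw; move: k h.
suff: [set w | forall k h, E k h -> E k.+1 (gr_act f f' w h)]%classic w by [].
apply: Hw; split.
  split; first split=> [k h _|x y Hx Hy k h Eh] /=.
  - have := E0 k.+1; congr E.
    by apply/funext => x; rewrite /gr_act gr_extend0.
  - by rewrite gr_actB; apply: EB; [apply: Hx|apply: Hy].
  move=> a x Hx; split=> k h Eh; rewrite (gr_actM fK f'K frel).
    by apply: (filtration_gr_act E0 EB Ef Ef'); apply: Hx.
  by apply: Hx; apply: (filtration_gr_act E0 EB Ef Ef').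
move=> _ [i ->] k h Eh /=; rewrite gr_actB !gr_act_elt.
have := Ed i Eh; congr E; apply/funext => x /=.
by rewrite (pg_act_gen fK f'K frel) (pg_act_genV fK f'K frel).
Qed.

Lemma vassiliev_filtration_act m w k h :
  @vassiliev_filtration n m w -> E k h -> E (k + m) (gr_act f f' w h).
Proof.
elim: m w k h => [|m IHm] w k h.
  by move=> _; rewrite addn0; apply: (filtration_gr_act E0 EB Ef Ef').
rewrite /vassiliev_filtration /= => Hw; move: k h; move: w Hw; apply: ideal_mul_ind.
  split=> [k h _|x y Hx Hy k h Eh] /=.
    have := E0 (k + m.+1); congr E.
    by apply/funext => x; rewrite /gr_act gr_extend0.
  by rewrite gr_actB; apply: EB; [apply: Hx|apply: Hy].
move=> x y Hx Hy k h Eh; rewrite (gr_actM fK f'K frel) addnS -addSn.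
by apply: IHm => //; apply: singular_ideal_filtration.
Qed.

(** The variation of [h] under such a [g] has arbitrarily high degree. In a filtration that reaches
    0 it must vanish, which turns membership in all W^m into exact invariance. *)
Lemma undetected_act g k h :
  (forall m, @vassiliev_filtration n m (gr_elt g - 1)) -> E k h ->
  forall m, E (k + m) (fun x => h (act g x) - h x).
Proof.
move=> Hg Eh m; have := vassiliev_filtration_act (Hg m) Eh; congr E.
rewrite gr_actB -gr_elt1 !gr_act_elt; apply/funext => x /=.
by rewrite (pg_act1 fK f'K frel).
Qed.

End SphereFiltration.

(** * The action induced by forgetting a marked strand *)

Lemma foldl_enum_ord M (X : Type) (f : nat -> X -> X) x :
  foldl (fun y (i : 'I_M) => f i y) x (enum 'I_M ++ rev (enum 'I_M)) =
  foldl (fun y i => f i y) x (iota 0 M ++ rev (iota 0 M)).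
Proof.
rewrite -val_enum_ord -map_rev -map_cat.
by elim: (_ ++ _) x => //= c s IHs x.
Qed.

(* The generator numbered i + 1, with junk value 1 out of range. *)
Definition sg n i : sphere_braid_group n :=
  if insub i is Some k then @sphere_sigma n k else 1%g.

Lemma sgE n (i : 'I_n.-1) : sg n i = sphere_sigma i.
Proof. by rewrite /sg valK. Qed.

Lemma sphere_rel_act M (X : Type) (f f' : nat -> X -> X) :
  (forall i j, (i.+1 < j <= M)%N -> forall x, f i (f j x) = f j (f i x)) ->
  (forall i, (i < M)%N -> forall x, f i (f i.+1 (f i x)) = f i.+1 (f i (f i.+1 x))) ->
  (forall x, foldl (fun y i => f i y) x (iota 0 M.+1 ++ rev (iota 0 M.+1)) = x) ->
  forall u v, @sphere_braid_rel M.+2 u v ->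
  word_act (fun i : 'I_M.+1 => f i) (fun i : 'I_M.+1 => f' i) u =1
  word_act (fun i : 'I_M.+1 => f i) (fun i : 'I_M.+1 => f' i) v.
Proof.
move=> Hfar Hnear Hsph u v [i j ij|i j ij|] x.
- have := ltn_ord i; have := ltn_ord j; rewrite /= => Hj Hi.
  by case/orP: ij => ij; [rewrite /= (Hfar i j)|rewrite /= (Hfar j i)]; rewrite // ij.
- by have := ltn_ord j; rewrite /= ij => Hj; rewrite Hnear.
by rewrite word_act_gen foldl_enum_ord.
Qed.

(* With k < M and j <= M, these are the relations that hold in the stabiliser
   of the last position between s k = sigma_k and the loop a j of the last strand
   around the j-th one, all acting on the right. *)
Record marked_system (M : nat) (X : Type) (s s' a a' : nat -> X -> X) : Prop :=
  MarkedSystem {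
  ms_sK : forall k, (k < M)%N -> cancel (s k) (s' k);
  ms_s'K : forall k, (k < M)%N -> cancel (s' k) (s k);
  ms_aK : forall j, (j <= M)%N -> cancel (a j) (a' j);
  ms_a'K : forall j, (j <= M)%N -> cancel (a' j) (a j);
  ms_far : forall i j, (i.+1 < j < M)%N -> forall x, s i (s j x) = s j (s i x);
  ms_near : forall i, (i.+1 < M)%N ->
    forall x, s i (s i.+1 (s i x)) = s i.+1 (s i (s i.+1 x));
  ms_s_a : forall k j, (k < M)%N -> (j <= M)%N -> j != k -> j != k.+1 ->
    forall x, a j (s k x) = s k (a j x);
  ms_s_a_shift : forall k, (k < M)%N ->
    forall x, a k (s k x) = s k (a k.+1 x);
  ms_s_aa : forall k, (k < M)%N ->
    forall x, s k (a k.+1 (a k x)) = a k.+1 (a k (s k x));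
  ms_a_prod : forall x, foldl (fun y j => a j y) x (iota 0 M.+1) = x;
  ms_sphere : forall x,
    foldl (fun y k => s k y) (a M (foldl (fun y k => s k y) x (iota 0 M)))
      (rev (iota 0 M)) = x }.

Section MarkedAction.
Variables (M : nat) (X : Type) (s s' a a' : nat -> X -> X).
Hypothesis D : marked_system M s s' a a'.
Let sK := ms_sK D.
Let s'K := ms_s'K D.
Let aK := ms_aK D.
Let a'K := ms_a'K D.
Let s_far := ms_far D.
Let s_near := ms_near D.
Let s_a := ms_s_a D.
Let s_a_shift := ms_s_a_shift D.
Let s_aa := ms_s_aa D.
Let a_prod := ms_a_prod D.
Let s_sphere := ms_sphere D.

(* The marked strand occupies position p.1, which ranges over 0, ..., M.+1;
   the other positions are irrelevant and left fixed. *)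
Definition marked_act i (p : nat * X) : nat * X :=
  if (M.+1 < p.1)%N then p else
  if (i.+1 < p.1)%N then (p.1, s i p.2) else
  if p.1 == i.+1 then (i, p.2) else
  if p.1 == i then (i.+1, a i p.2) else (p.1, s i.-1 p.2).

Definition marked_act' i (p : nat * X) : nat * X :=
  if (M.+1 < p.1)%N then p else
  if (i.+1 < p.1)%N then (p.1, s' i p.2) else
  if p.1 == i.+1 then (i, a' i p.2) else
  if p.1 == i then (i.+1, p.2) else (p.1, s' i.-1 p.2).

Lemma marked_act_out i j x : (M.+1 < j)%N -> marked_act i (j, x) = (j, x).
Proof. by rewrite /marked_act /= => ->. Qed.

Lemma marked_act_hi i j x : (i.+1 < j <= M.+1)%N ->
  marked_act i (j, x) = (j, s i x).
Proof. by case/andP=> ij jM; rewrite /marked_act /= ltnNge jM ij. Qed.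

Lemma marked_act_down i x : (i <= M)%N -> marked_act i (i.+1, x) = (i, x).
Proof.
by move=> iM; rewrite /marked_act /= ltnNge !ltnS iM ltnn eqxx.
Qed.

(** A pair [(j, x)] stands for [x] followed by the braid [last_to j] defined below. Since [last_to i
    * s i = push_gen i * last_to i.+1], the upward crossing carries the loop [a i], while the
    downward one, [last_to i.+1 * s i = last_to i], carries nothing. *)
Lemma marked_act_up i x : (i <= M)%N -> marked_act i (i, x) = (i.+1, a i x).
Proof.
move=> iM; rewrite /marked_act /= ltnNge leqW //= [(i.+1 < i)%N]ltnNge leqW //=.
by rewrite ltn_eqF // eqxx.
Qed.

(** The remaining strands are numbered without the marked one, so a crossing to its right has its
    index lowered by one. *)
Lemma marked_act_lo i j x : (j <= i < M)%N ->
  marked_act i.+1 (j, x) = (j, s i x).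
Proof.
case/andP=> ji iM; rewrite /marked_act /=.
have -> : (M.+1 < j)%N = false by lia.
have -> : (i.+2 < j)%N = false by lia.
have -> : (j == i.+2) = false by lia.
by have -> : (j == i.+1) = false by lia.
Qed.

Lemma marked_actK i : (i <= M)%N -> cancel (marked_act i) (marked_act' i).
Proof.
move=> iM [j x].
have [Mj|jM] := ltnP M.+1 j; first by rewrite marked_act_out // /marked_act' /= Mj.
have [ij|ji] := ltnP i.+1 j.
  rewrite marked_act_hi ?ij // /marked_act' /= ltnNge jM ij /= sK //; lia.
have [->|ne1] := eqVneq j i.+1.
  rewrite marked_act_down // /marked_act' /= ltnNge leqW //= [(i.+1 < i)%N]ltnNge leqW //=.
  by rewrite ltn_eqF // eqxx.
have [->|ne2] := eqVneq j i.
  rewrite marked_act_up // /marked_act' /= ltnNge ltnS iM ltnn eqxx /=.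
  by rewrite aK.
case: i iM ji ne1 ne2 => [|i] iM ji ne1 ne2; first by lia.
rewrite marked_act_lo ?/marked_act' /=; last lia.
have -> : (M.+1 < j)%N = false by lia.
have -> : (i.+2 < j)%N = false by lia.
by rewrite (negPf ne1) (negPf ne2) sK.
Qed.

Lemma marked_act'K i : (i <= M)%N -> cancel (marked_act' i) (marked_act i).
Proof.
move=> iM [j x]; rewrite /marked_act' /=.
have [Mj|jM] := ltnP M.+1 j; first by rewrite marked_act_out.
have [ij|ji] := ltnP i.+1 j; first by rewrite marked_act_hi ?ij // s'K //; lia.
have [->|ne1] := eqVneq j i.+1; first by rewrite marked_act_up // a'K.
have [->|ne2] := eqVneq j i; first by rewrite marked_act_down.
case: i iM ji ne1 ne2 => [|i] iM ji ne1 ne2; first by lia.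
by rewrite marked_act_lo ?s'K //; lia.
Qed.

Lemma marked_act_far i k : (i.+1 < k <= M)%N ->
  forall p, marked_act i (marked_act k p) = marked_act k (marked_act i p).
Proof.
case: k => // k; rewrite ltnS => ikM [j x].
have [Mj|jM] := ltnP M.+1 j; first by rewrite !marked_act_out.
have [kj|jk] := ltnP k.+2 j.
  by rewrite !marked_act_hi 1?s_far //; lia.
have [->|ne1] := eqVneq j k.+2.
  by rewrite marked_act_down ?[marked_act i _]marked_act_hi ?marked_act_down //; lia.
have [->|ne2] := eqVneq j k.+1.
  rewrite marked_act_up ?[marked_act i _]marked_act_hi ?marked_act_up; try lia.
  by rewrite s_a //; lia.
have [ij|ji] := ltnP i.+1 j.
  rewrite marked_act_lo ?[marked_act i _]marked_act_hi ?marked_act_lo; try lia.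
  by rewrite s_far //; lia.
have [->|ne3] := eqVneq j i.+1.
  by rewrite marked_act_lo ?marked_act_down ?marked_act_lo //; lia.
have [->|ne4] := eqVneq j i.
  rewrite marked_act_lo ?[marked_act i _]marked_act_up ?marked_act_lo; try lia.
  by rewrite s_a //; lia.
case: i ikM ji ne3 ne4 => [|i] ikM ji ne3 ne4; first lia.
by rewrite !marked_act_lo 1?s_far //; lia.
Qed.

(** The marked strand takes part when it starts at [i.+2], [i.+1] or [i]. The first start picks up
    no loop; the second reduces to [ms_s_a_shift] and the third to [ms_s_aa]. *)
Lemma marked_act_near i : (i < M)%N ->
  forall p, marked_act i (marked_act i.+1 (marked_act i p)) =
            marked_act i.+1 (marked_act i (marked_act i.+1 p)).
Proof.
move=> iM [j x].
have [Mj|jM] := ltnP M.+1 j; first by rewrite !marked_act_out.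
have [ij|ji] := ltnP i.+2 j.
  by rewrite !marked_act_hi 1?s_near //; lia.
have [->|ne1] := eqVneq j i.+2.
  rewrite (@marked_act_hi i i.+2) 1?marked_act_down; try lia.
  by rewrite !marked_act_down ?marked_act_lo //; lia.
have [->|ne2] := eqVneq j i.+1.
  rewrite marked_act_down ?(@marked_act_up i.+1) ?(@marked_act_hi i i.+2); try lia.
  by rewrite marked_act_down ?marked_act_lo ?marked_act_up ?s_a_shift //; lia.
have [->|ne3] := eqVneq j i.
  rewrite (@marked_act_lo i i) ?(@marked_act_up i) ?(@marked_act_up i.+1); try lia.
  by rewrite marked_act_hi ?s_aa //; lia.
case: i iM ji ne1 ne2 ne3 => [|i] iM ji ne1 ne2 ne3; first lia.
by rewrite !marked_act_lo 1?s_near //; lia.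
Qed.

Local Notation fold_marked := (foldl (fun y i => marked_act i y)).
Local Notation fold_s := (foldl (fun y k => s k y)).

Lemma fold_marked_up l x : (l <= M.+1)%N ->
  fold_marked (0%N, x) (iota 0 l) = (l, foldl (fun y j => a j y) x (iota 0 l)).
Proof.
elim: l => // l IHl lM.
by rewrite -{1 3}(addn1 l) !iotaD !foldl_cat /= add0n IHl ?marked_act_up // ltnW.
Qed.

Lemma fold_marked_down l x : (l <= M.+1)%N ->
  fold_marked (l, x) (rev (iota 0 l)) = (0%N, x).
Proof.
elim: l => // l IHl lM.
by rewrite -{2}(addn1 l) iotaD rev_cat /= add0n marked_act_down // IHl // ltnW.
Qed.

Lemma fold_marked_hi j t x : (j <= M.+1)%N -> all (fun i => i.+1 < j)%N t ->
  fold_marked (j, x) t = (j, fold_s x t).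
Proof.
move=> jM; elim: t x => //= i t IHt x /andP [ij Ht].
by rewrite marked_act_hi ?IHt // ij jM.
Qed.

Lemma fold_marked_lo j t x : all (fun i => j <= i < M)%N t ->
  fold_marked (j, x) (map succn t) = (j, fold_s x t).
Proof.
elim: t x => //= i t IHt x /andP [ij Ht].
by rewrite marked_act_lo ?IHt.
Qed.

Lemma a_fold_s j d y : (j + d <= M)%N ->
  a j (fold_s y (rev (iota j d))) = fold_s (a (j + d)%N y) (rev (iota j d)).
Proof.
elim: d j => [|d IHd] j jM /=; first by rewrite addn0.
rewrite rev_cons -cats1 !foldl_cat /= s_a_shift ?IHd; try lia.
by rewrite addSnnS.
Qed.

(** From position 0 the marked strand goes around all the others and comes back, which is
    [ms_a_prod]. From [j.+1] it is taken down by generator [j] and up again on the way back, leaving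
    one loop [a j] between the moves of the others; [a_fold_s] turns it into [a M] at the turning
    point, and [ms_sphere] applies. *)
Lemma marked_act_sphere p :
  fold_marked p (iota 0 M.+1 ++ rev (iota 0 M.+1)) = p.
Proof.
case: p => j x; have [Mj|jM] := ltnP M.+1 j.
  by elim: (_ ++ _) => //= i t; rewrite marked_act_out.
rewrite foldl_cat; case: j jM => [|j] jM.
  by rewrite fold_marked_up // a_prod fold_marked_down.
have -> : iota 0 M.+1 = iota 0 j ++ j :: map succn (iota j (M - j)).
  have -> : M.+1 = (j + (M - j).+1)%N by lia.
  rewrite iotaD /= add0n -(addn1 j) addnC iotaDl; congr (_ ++ _ :: map _ _).
have Hall t : {subset t <= iota j (M - j)} -> all (fun i => j <= i < M)%N t.
  by move=> Ht; apply/allP => i /Ht; rewrite mem_iota; lia.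
have Hall' t : {subset t <= iota 0 j} -> all (fun i => i.+1 < j.+1)%N t.
  by move=> Ht; apply/allP => i /Ht; rewrite mem_iota; lia.
rewrite rev_cat rev_cons cat_rcons !foldl_cat /= -map_rev.
rewrite fold_marked_hi ?Hall' // marked_act_down // fold_marked_lo ?Hall //.
rewrite fold_marked_lo ?Hall //; last by move=> i; rewrite mem_rev.
rewrite marked_act_up // fold_marked_hi ?Hall' //; last by move=> i; rewrite mem_rev.
rewrite a_fold_s; last lia.
have jMj : (j + (M - j))%N = M by lia.
by rewrite jMj -!foldl_cat -rev_cat -{1 3}(add0n j) -iotaD jMj s_sphere.
Qed.

Let f (i : 'I_M.+1) := marked_act i.
Let f' (i : 'I_M.+1) := marked_act' i.

Lemma marked_act_rel u v : @sphere_braid_rel M.+2 u v ->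
  word_act f f' u =1 word_act f f' v.
Proof.
apply: sphere_rel_act; first exact: marked_act_far.
  exact: marked_act_near.
exact: marked_act_sphere.
Qed.

Lemma marked_actK_ord (i : 'I_M.+1) : cancel (f i) (f' i).
Proof. by apply: marked_actK; have := ltn_ord i. Qed.

Lemma marked_act'K_ord (i : 'I_M.+1) : cancel (f' i) (f i).
Proof. by apply: marked_act'K; have := ltn_ord i. Qed.

Definition sb_act : sphere_braid_group M.+2 -> nat * X -> nat * X :=
  pg_act f f'.

Lemma sb_act1 p : sb_act 1%g p = p.
Proof. exact: (pg_act1 marked_actK_ord marked_act'K_ord marked_act_rel). Qed.

Lemma sb_actM g h p : sb_act (g * h)%g p = sb_act h (sb_act g p).
Proof. exact: (pg_actM marked_actK_ord marked_act'K_ord marked_act_rel). Qed.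

Lemma sb_actK g : cancel (sb_act g) (sb_act g^-1%g).
Proof. by move=> p; rewrite -sb_actM mulgV sb_act1. Qed.

Lemma sb_act_sg i p : (i <= M)%N -> sb_act (sg M.+2 i) p = marked_act i p.
Proof.
move=> iM; rewrite (sgE (Ordinal (iM : (i < M.+2.-1)%N))).
exact: (pg_act_gen marked_actK_ord marked_act'K_ord marked_act_rel).
Qed.

Section MarkedFiltration.
Variables (A : zmodType) (E : nat -> (X -> A) -> Prop).
Hypothesis E0 : forall k, E k (fun=> 0).
Hypothesis EB : forall k h h', E k h -> E k h' -> E k (fun x => h x - h' x).
Hypothesis Es : forall k h i, (i < M)%N -> E k h -> E k (h \o s i).
Hypothesis Es' : forall k h i, (i < M)%N -> E k h -> E k (h \o s' i).
Hypothesis Ea : forall k h i, (i <= M)%N -> E k h -> E k (h \o a i).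
Hypothesis Ea' : forall k h i, (i <= M)%N -> E k h -> E k (h \o a' i).
Hypothesis Eds : forall k h i, (i < M)%N -> E k h ->
  E k.+1 (fun x => h (s i x) - h (s' i x)).
Hypothesis Eda : forall k h i, (i <= M)%N -> E k h ->
  E k.+1 (fun x => h (a i x) - h x).
Hypothesis Eda' : forall k h i, (i <= M)%N -> E k h ->
  E k.+1 (fun x => h x - h (a' i x)).

Lemma undetected_marked_act g k (h : nat * X -> A) :
  (forall m, @vassiliev_filtration M.+2 m (gr_elt g - 1)) ->
  (forall j, E k (fun x => h (j, x))) ->
  forall m j, E (k + m) (fun x => h (sb_act g (j, x)) - h (j, x)).
Proof.
move=> Hg Eh m.
(* The degree of a function of marked configurations is measured separately at each position of the
   marked strand. *)
pose E' l (h : nat * X -> A) := forall j, E l (fun x => h (j, x)).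
apply: (@undetected_act M.+2 _ f f' marked_actK_ord marked_act'K_ord
  marked_act_rel A E') => //.
- by move=> l j; exact: E0.
- by move=> l h1 h2 Eh1 Eh2 j; apply: EB.
- move=> l h1 [i Hi] Eh1 j; rewrite /f /comp /=; have {Hi} iM : (i <= M)%N by [].
  rewrite /marked_act /=.
  case: ltnP => [_|jM]; first exact: Eh1.
  case: ltnP => [ij|ji]; first by apply: (Es (h := fun x => h1 (j, x))); [lia|].
  case: eqVneq => [ij|ij]; first exact: Eh1.
  case: eqVneq => ij2; first exact: (Ea (h := fun x => h1 (i.+1, x))).
  by apply: (Es (h := fun x => h1 (j, x))); [lia|].
- move=> l h1 [i Hi] Eh1 j; rewrite /f' /comp /=; have {Hi} iM : (i <= M)%N by [].
  rewrite /marked_act' /=.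
  case: ltnP => [_|jM]; first exact: Eh1.
  case: ltnP => [ij|ji]; first by apply: (Es' (h := fun x => h1 (j, x))); [lia|].
  case: eqVneq => [ij|ij]; first exact: (Ea' (h := fun x => h1 (i, x))).
  case: eqVneq => ij2; first exact: Eh1.
  by apply: (Es' (h := fun x => h1 (j, x))); [lia|].
- move=> l h1 [i Hi] Eh1 j; rewrite /f /f' /=; have {Hi} iM : (i <= M)%N by [].
  rewrite /marked_act /marked_act' /=.
  case: ltnP => [_|jM].
    by have := E0 l.+1; congr E; apply/funext => x; rewrite subrr.
  case: ltnP => [ij|ji]; first by apply: (Eds (h := fun x => h1 (j, x))); [lia|].
  case: eqVneq => [ij|ij]; first exact: (Eda' (h := fun x => h1 (i, x))).
  case: eqVneq => ij2; first exact: (Eda (h := fun x => h1 (i.+1, x))).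
  by apply: (Eds (h := fun x => h1 (j, x))); [lia|].
Qed.

End MarkedFiltration.
End MarkedAction.

(** * The sphere braid group modulo the pushes of the last strand *)

Local Open Scope group_scope.

Definition word_val (C : Type) (K : groupType) (x : C -> K) (w : word C) : K :=
  \prod_(l <- w) (if l.2 then (x l.1)^-1 else x l.1).

Lemma word_val_cat C (K : groupType) (x : C -> K) u v :
  word_val x (u ++ v) = word_val x u * word_val x v.
Proof. exact: big_cat. Qed.

Lemma word_val_inv C (K : groupType) (x : C -> K) u :
  word_val x (inv_word u) = (word_val x u)^-1.
Proof.
rewrite /word_val; elim: u => [|[c b] u IHu]; first by rewrite big_nil invg1.
rewrite /inv_word /= rev_cons big_rcons big_cons invgM /= -IHu.
by case: b; rewrite ?invgK.
Qed.

Lemma word_val_gen C (K : groupType) (x : C -> K) s :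
  word_val x (gen_word s) = \prod_(c <- s) x c.
Proof. by rewrite /word_val /gen_word big_map. Qed.

Section SphereRelations.
Variable n : nat.
Local Notation sgn := (sg n).

Lemma pg_class_sg (w : word 'I_n.-1) :
  pg_class (@sphere_braid_rel n) w = word_val (fun i : 'I_n.-1 => sgn i) w.
Proof.
rewrite /word_val; elim: w => [|[i b] w IHw]; first by rewrite big_nil.
rewrite big_cons -IHw -cat1s pg_classM; congr (_ * _) => /=.
by case: b; rewrite sgE // /sphere_sigma pg_class_inv.
Qed.

Lemma word_val_sg_eq u v : word_eq (@sphere_braid_rel n) u v ->
  word_val (fun i : 'I_n.-1 => sgn i) u = word_val (fun i : 'I_n.-1 => sgn i) v.
Proof. by rewrite -!pg_class_sg => /pg_classP. Qed.

Lemma sg_far i j : (i.+1 < j < n.-1)%N -> commute (sgn i) (sgn j).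
Proof.
case/andP=> ij jn; have iN : (i < n.-1)%N by lia.
have := word_val_sg_eq (word_eq_rel (@braid_far n (Ordinal iN) (Ordinal jn) _)).
by rewrite !word_val_gen !big_cons !big_nil !mulg1 /= ij; apply.
Qed.

Lemma sg_near i : (i.+1 < n.-1)%N ->
  sgn i * (sgn i.+1 * sgn i) = sgn i.+1 * (sgn i * sgn i.+1).
Proof.
move=> jn; have iN : (i < n.-1)%N by lia.
have := word_val_sg_eq (word_eq_rel (@braid_near n (Ordinal iN) (Ordinal jn) _)).
by rewrite !word_val_gen !big_cons !big_nil !mulg1 /=; apply.
Qed.

Lemma sg_sphere :
  \prod_(i <- iota 0 n.-1) sgn i * \prod_(i <- rev (iota 0 n.-1)) sgn i = 1.
Proof.
have := word_val_sg_eq (word_eq_rel (@braid_sphere n)).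
rewrite word_val_gen [RHS]big_nil; apply: etrans.
by rewrite big_cat -!val_enum_ord -map_rev !big_map.
Qed.

End SphereRelations.

Section BraidConjugation.
Variables (K : groupType) (a b c : K).
Hypotheses (ac : commute a c) (aba : a * (b * a) = b * (a * b)).

(** Used with [a = s k], [b = s k.+1] and [c = last_to k.+2]: then [(a * a) ^ (c * b)^-1] and
    [(b * b) ^ c^-1] are the loops of the last strand around two neighbouring strands. *)
Lemma braid_conj_up : ((a * a) ^ (c * b)^-1) ^ a^-1 = (b * b) ^ c^-1.
Proof.
have ab : a ^ (a * b)^-1 = b by rewrite conjgE invgK -!mulgA !mulgA -(mulgA a) aba !gnorm.
rewrite -conjgM -invgM mulgA ac -mulgA invgM conjgM; congr (_ ^ _).
by rewrite conjMg ab.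
Qed.

Lemma braid_conj_cross :
  ((b * b) ^ c^-1) ^ a^-1 = ((a * a) ^ (c * b)^-1) ^ ((b * b) ^ c^-1).
Proof.
have ab : b ^ a^-1 = a ^ b.
  rewrite !conjgE invgK; apply: (mulgI b); apply: (mulIg a).
  by rewrite -!mulgA mulVg mulg1 mulVKg aba.
have -> : ((b * b) ^ c^-1) ^ a^-1 = ((b * b) ^ a^-1) ^ c^-1.
  by rewrite -!conjgM -!invgM ac.
rewrite conjMg ab -conjMg -!conjgM; congr (_ ^ _).
by rewrite invgM conjgE invgK -!mulgA mulKg mulKg.
Qed.

End BraidConjugation.

Section LastStrand.
Variable M : nat.
Local Notation G := (sphere_braid_group M.+2).
Local Notation s := (sg M.+2).

(** The braid [s M ... s j] carries the last strand to position [j]. These braids represent the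
    cosets of the stabiliser of the last position. *)
Definition last_to j : G := \prod_(i <- rev (iota j (M.+1 - j))) s i.

Lemma last_to_max : last_to M.+1 = 1.
Proof. by rewrite /last_to subnn big_nil. Qed.

Lemma last_toS j : (j <= M)%N -> last_to j = last_to j.+1 * s j.
Proof.
move=> jM; rewrite /last_to subSn //= rev_cons -cats1 big_cat big_seq1.
by rewrite subSS.
Qed.

Lemma down_ind (P : nat -> Prop) :
  P M.+1 -> (forall j, (j <= M)%N -> P j.+1 -> P j) ->
  forall j, (j <= M.+1)%N -> P j.
Proof.
move=> P0 PS j /subnKC; move: (M.+1 - j)%N => d.
elim: d j => [|d IHd] j jd; first by rewrite -(addn0 j) jd.
by apply: PS; [lia|apply: IHd; lia].
Qed.

Lemma last_to_far i j : (i.+1 < j <= M.+1)%N -> commute (s i) (last_to j).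
Proof.
case/andP=> + jM; move: j jM; apply: down_ind => [|j jM IHj] ij.
  by rewrite last_to_max; apply: commute1.
rewrite last_toS //; apply: commuteM; first by apply: IHj; lia.
by apply: sg_far; rewrite /= ij.
Qed.

Lemma last_to_shift i j : (j <= i)%N -> (i < M)%N ->
  last_to j * s i.+1 = s i * last_to j.
Proof.
move=> + iM; have [jM ji|] := leqP j M.+1; last lia.
move: j jM ji; apply: down_ind => [|j jM IHj] ji; first lia.
rewrite last_toS // -mulgA; have [->|ne] := eqVneq j i; last first.
  have -> : s j * s i.+1 = s i.+1 * s j by apply: sg_far => /=; lia.
  by rewrite mulgA IHj ?mulgA //; lia.
rewrite last_toS // -!mulgA -sg_near /=; last lia.
by rewrite mulgA -last_to_far ?mulgA //; lia.
Qed.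

(* The last strand travels to the j-th one, turns once around it and comes back. *)
Definition push_gen j : G := (s j * s j) ^ (last_to j.+1)^-1.

Lemma push_genE j : push_gen j = last_to j.+1 * (s j * s j) / last_to j.+1.
Proof. by rewrite /push_gen conjgE invgK mulgA. Qed.

Lemma push_gen_far k j : (k < M)%N -> (j <= M)%N -> j != k -> j != k.+1 ->
  push_gen j ^ s k = push_gen j.
Proof.
move=> kM jM jk jk1; have [kj|jk'] := ltnP k j.
  apply/conjg_fixP/commgP/commute_sym; rewrite push_genE.
  have c1 : commute (s k) (last_to j.+1) by apply: last_to_far; lia.
  have c2 : commute (s k) (s j) by apply: sg_far => /=; lia.
  by do ![apply: commuteM => //|apply: commuteV].
suff H : push_gen j ^ (s k)^-1 = push_gen j by rewrite -{1}H conjgKV.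
rewrite /push_gen -conjgM -invgM -last_to_shift; [|lia|lia].
rewrite invgM conjgM; congr (_ ^ _); apply/conjg_fixP/commgP.
have c : commute (s j) (s k.+1)^-1 by apply/commuteV/sg_far => /=; lia.
by apply/commute_sym/commuteM; apply: commute_sym.
Qed.

Lemma push_gen_up k : (k < M)%N -> push_gen k ^ (s k)^-1 = push_gen k.+1.
Proof.
move=> kM; rewrite /push_gen last_toS //.
by apply: braid_conj_up; [apply: last_to_far|apply: sg_near => /=]; lia.
Qed.

Lemma push_gen_cross k : (k < M)%N ->
  push_gen k.+1 ^ (s k)^-1 = push_gen k ^ push_gen k.+1.
Proof.
move=> kM; rewrite /push_gen (last_toS (j := k.+1)) //.
by apply: braid_conj_cross; [apply: last_to_far|apply: sg_near => /=]; lia.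
Qed.

(** The partial products starting at [j] telescope to [(s M ... s j) (s j ... s M)]. At [j = 0] the
    two factors are inverse to each other by the sphere relation. *)
Lemma push_gen_prod : \prod_(j <- iota 0 M.+1) push_gen j = 1.
Proof.
suff H j : (j <= M.+1)%N -> \prod_(i <- iota j (M.+1 - j)) push_gen i =
    last_to j * \prod_(i <- iota j (M.+1 - j)) s i.
  have := H 0%N isT; rewrite subn0 => ->; rewrite /last_to subn0.
  by have /mulg1_eq <- := sg_sphere M.+2; rewrite mulVg.
move: j; apply: down_ind => [|j jM IHj].
  by rewrite subnn !big_nil last_to_max mulg1.
rewrite subSn //= !big_cons -subSS IHj push_genE (last_toS jM).
by rewrite -!mulgA mulKg.
Qed.

(** The subgroup generated by the loops of the last strand. Membership carries a word in the loops,
    so that an action of the element can be computed letter by letter. *)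
Definition pushes (g : G) : Prop := exists2 w : word nat,
  all (fun l => l.1 <= M)%N w & g = word_val push_gen w.

Lemma pushes1 : pushes 1.
Proof. by exists [::]; rewrite // /word_val big_nil. Qed.

Lemma pushes_gen j : (j <= M)%N -> pushes (push_gen j).
Proof.
by move=> jM; exists [:: (j, false)]; rewrite /= ?jM // /word_val big_seq1.
Qed.

Lemma pushesM g h : pushes g -> pushes h -> pushes (g * h).
Proof.
move=> [u Hu ->] [v Hv ->]; exists (u ++ v); first by rewrite all_cat Hu.
by rewrite word_val_cat.
Qed.

Lemma pushesV g : pushes g -> pushes g^-1.
Proof.
move=> [u Hu ->]; exists (inv_word u); last by rewrite word_val_inv.
by rewrite /inv_word all_rev all_map.
Qed.

Lemma push_gen_down k : (k < M)%N ->
  push_gen k ^ s k = push_gen k.+1 ^ (push_gen k)^-1.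
Proof.
move=> kM; apply: (canRL (conjgK _)); apply: (@conjg_inj _ (s k)^-1).
by rewrite conjJg conjgK push_gen_up // -push_gen_cross.
Qed.

(** Conjugation by [s k] permutes the loops up to conjugation by loops: only those around strands
    [k] and [k.+1] change, by [push_gen_up], [push_gen_down] and [push_gen_cross]. *)
Lemma pushesJ g k (b : bool) : (k < M)%N ->
  pushes g -> pushes (g ^ (if b then (s k)^-1 else s k)).
Proof.
move=> kM [u + ->]; rewrite /word_val; set x := (if b then _ else _).
elim: u => [|[j c] u IHu] /=; first by rewrite big_nil conj1g => _; apply: pushes1.
case/andP=> jM /IHu Hu; rewrite big_cons conjMg /=; apply: pushesM => //.
suff Hj : pushes (push_gen j ^ x).
  by case: c => //; rewrite conjVg; apply: pushesV.
have PJ i l : (i <= M)%N -> (l <= M)%N -> forall c : bool,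
    pushes (push_gen i ^ (if c then (push_gen l)^-1 else push_gen l)).
  move=> iM lM d; rewrite conjgE; have Pi := pushes_gen iM.
  have Pl := pushes_gen lM; have Pl' := pushesV Pl.
  by case: d; rewrite ?invgK; apply: (pushesM _ (pushesM Pi _)).
have [->|jk] := eqVneq j k.
  rewrite /x; case: b {x Hu IHu} => /=; first by rewrite push_gen_up //; apply: pushes_gen.
  by rewrite push_gen_down //; apply: (PJ _ _ _ _ true) => //; apply: ltnW.
have [->|jk1] := eqVneq j k.+1.
  rewrite /x; case: b {x Hu IHu} => /=.
    by rewrite push_gen_cross //; apply: (PJ _ _ _ _ false) => //; apply: ltnW.
  by rewrite -push_gen_up // conjgKV; apply/pushes_gen/ltnW.
have Hjk := push_gen_far kM jM jk jk1.
rewrite /x; case: b {x Hu IHu} => /=; last by rewrite Hjk; apply: pushes_gen.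
by rewrite -{1}Hjk conjgK; apply: pushes_gen.
Qed.

(** A braid on one strand less is extended by a last strand at rest. This is defined on words
    because the sphere relation with one strand less survives only modulo [pushes]. *)
Definition lift_word (w : word 'I_M) : G := word_val (fun i : 'I_M => s i) w.

Lemma pushesJ_lift g u : pushes g -> pushes (g ^ lift_word u).
Proof.
rewrite /lift_word /word_val.
elim: u g => [|[j b] u IHu] g Hg; first by rewrite big_nil conjg1.
rewrite big_cons conjgM /=; apply: IHu.
by have := pushesJ b (ltn_ord j) Hg.
Qed.

Lemma pushesJV_lift g u : pushes g -> pushes (g ^ (lift_word u)^-1).
Proof. by rewrite /lift_word -word_val_inv; apply: pushesJ_lift. Qed.

Lemma lift_word_cat u v : lift_word (u ++ v) = lift_word u * lift_word v.
Proof. exact: word_val_cat. Qed.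

(** The braid relations lift exactly. For the sphere relation with lifted sides [P] and [Q], the
    sphere relation above gives [P (s M)^2 Q = 1], so [P Q] is conjugate to the inverse of the loop
    [push_gen M = (s M)^2]. *)
Lemma lift_word_rel u v : @sphere_braid_rel M.+1 u v ->
  pushes (lift_word u / lift_word v).
Proof.
case=> [i j ij|i j ij|].
- suff -> : lift_word (gen_word [:: i; j]) = lift_word (gen_word [:: j; i]).
    by rewrite mulgV; apply: pushes1.
  rewrite /lift_word !word_val_gen !big_cons !big_nil !mulg1.
  have := ltn_ord i; have := ltn_ord j; rewrite /= => Hj Hi.
  by case/orP: ij => ij; [|symmetry];
    [apply: (@sg_far M.+2 i j)|apply: (@sg_far M.+2 j i)]; rewrite ij /= ltnW.
- suff -> : lift_word (gen_word [:: i; j; i]) = lift_word (gen_word [:: j; i; j]).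
    by rewrite mulgV; apply: pushes1.
  rewrite /lift_word !word_val_gen !big_cons !big_nil !mulg1 ij.
  by apply: (@sg_near M.+2 i); have := ltn_ord j; rewrite /= ij => /ltnW.
have {1}-> : gen_word (enum 'I_M ++ rev (enum 'I_M)) =
    gen_word (enum 'I_M) ++ gen_word (rev (enum 'I_M)) by rewrite /gen_word map_cat.
rewrite lift_word_cat [X in _ / X]big_nil invg1 mulg1.
have E t : lift_word (gen_word t) = \prod_(i <- map val t) s i.
  by rewrite /lift_word word_val_gen big_map.
set P := lift_word _; have EP : P = \prod_(i <- iota 0 M) s i.
  by rewrite /P E val_enum_ord.
rewrite E map_rev val_enum_ord; set Q := \prod_(i <- rev _) _.
have : P * (s M * s M) * Q = 1.
  rewrite EP; have := sg_sphere M.+2; rewrite -[M.+2.-1](addn1 M) iotaD rev_cat.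
  by rewrite !big_cat !big_seq1 add0n !mulgA.
move=> PQ; have -> : Q = (P * (s M * s M))^-1 by rewrite (mulg1_eq PQ).
have -> : P * (P * (s M * s M))^-1 = (push_gen M)^-1 ^ P^-1.
  by rewrite /push_gen last_to_max invg1 conjg1 conjgE invgK invgM.
by apply: pushesJV_lift; apply/pushesV/pushes_gen.
Qed.

Lemma lift_word_eq u v : word_eq (@sphere_braid_rel M.+1) u v ->
  pushes (lift_word u / lift_word v).
Proof.
elim=> {u v} [u|u v _ IH|u v w _ IH1 _ IH2|u u' v v' _ IH1 _ IH2|l|u v /lift_word_rel] //.
- by rewrite mulgV; apply: pushes1.
- by rewrite -invgF; apply: pushesV.
- by rewrite -(mulgVK (lift_word v) (lift_word u)) -mulgA; apply: pushesM.
- rewrite !lift_word_cat; have := pushesM (pushesJV_lift u IH2) IH1.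
  by rewrite conjgE invgK invgM !mulgA mulgVK.
rewrite [X in _ / X]big_nil invg1 mulg1 /lift_word /word_val !big_cons big_nil mulg1.
by case: l => i [] /=; rewrite ?mulgV ?mulVg; apply: pushes1.
Qed.

(** Products of this shape are stable under right multiplication by a letter, with the same four
    cases as [marked_act]: the letter either becomes a letter of the lifted word, or changes [j] and
    may create a loop. *)
Lemma lift_last_to_decomposition (g : G) : exists nu u j,
  [/\ pushes nu, (j <= M.+1)%N & g = nu * lift_word u * last_to j].
Proof.
rewrite -(pg_classK g) pg_class_sg; elim/last_ind: (repr g) => [|w [i b] IHw].
  exists 1, [::], M.+1; split=> //; first exact: pushes1.
  by rewrite last_to_max /lift_word /word_val !big_nil !mul1g.
have [nu [u [j [Hnu jM Ew]]]] := IHw.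
rewrite -cats1 word_val_cat {}Ew /word_val big_seq1 /= -/(word_val _ _).
have Hword (k : nat) (c : bool) : (k < M)%N ->
    last_to j * (if b then (s i)^-1 else s i) =
    (if c then (s k)^-1 else s k) * last_to j ->
  exists nu0 u0 j0, [/\ pushes nu0, (j0 <= M.+1)%N &
    nu * lift_word u * last_to j * (if b then (s i)^-1 else s i) =
    nu0 * lift_word u0 * last_to j0].
  move=> kM E; exists nu, (u ++ [:: (Ordinal kM, c)]), j; split=> //.
  by rewrite -mulgA E lift_word_cat /lift_word /word_val big_seq1 /= !mulgA.
(* A loop created to the right of the lifted word is moved to its left, where normality keeps it in
   [pushes]. *)
have Hpush h j0 : pushes h -> (j0 <= M.+1)%N ->
    last_to j * (if b then (s i)^-1 else s i) = h * last_to j0 ->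
  exists nu0 u0 j0, [/\ pushes nu0, (j0 <= M.+1)%N &
    nu * lift_word u * last_to j * (if b then (s i)^-1 else s i) =
    nu0 * lift_word u0 * last_to j0].
  move=> Hh j0M E; exists (nu * h ^ (lift_word u)^-1), u, j0; split=> //.
    by apply: pushesM => //; apply: pushesJV_lift.
  by rewrite -mulgA E conjgE invgK -!mulgA mulKg.
have iM : (i <= M)%N by have := ltn_ord i; rewrite ltnS.
move: {w IHw} (nat_of_ord i) iM Hword Hpush => {}i iM Hword Hpush.
have [ij|ji] := ltnP i.+1 j.
  apply: (Hword i b); first lia.
  have c : commute (s i) (last_to j) by apply: last_to_far; rewrite ij.
  by case: b {Hword Hpush} => //; apply: commuteV.
have [Ej|ne1] := eqVneq j i.+1.
  case: b {Hword} Hpush => Hpush.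
    apply: (Hpush (push_gen i)^-1 i); [exact/pushesV/pushes_gen|lia|].
    apply: (canRL (mulKg _)).
    by rewrite push_genE (last_toS iM) Ej -!mulgA mulKg mulgV mulg1.
  apply: (Hpush 1 i); [exact: pushes1|lia|].
  by rewrite mul1g (last_toS iM) Ej.
have [Ej|ne2] := eqVneq j i.
  case: b {Hword} Hpush => Hpush.
    apply: (Hpush 1 i.+1); [exact: pushes1|lia|].
    by rewrite Ej mul1g (last_toS iM) mulgK.
  apply: (Hpush (push_gen i) i.+1); [exact: pushes_gen|lia|].
  by rewrite Ej push_genE (last_toS iM) mulgVK mulgA.
case: i iM ji ne1 ne2 Hword {Hpush} => [|i] iM ji ne1 ne2 Hword; first lia.
apply: (Hword i b); first lia.
have E : last_to j * s i.+1 = s i * last_to j by apply: last_to_shift; lia.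
case: b {Hword} => //.
by apply: (mulgI (s i)); apply: (mulIg (s i.+1)); rewrite mulgA -E -!mulgA mulVg mulVKg mulg1.
Qed.

End LastStrand.

(** * The marked action evaluated on loops and lifted words *)

Section MarkedActionOnPushes.
Variables (M : nat) (X : Type) (s s' a a' : nat -> X -> X).
Hypothesis D : marked_system M s s' a a'.
Local Notation act := (sb_act s s' a a').

Lemma sb_act_last_to j x : (j <= M.+1)%N ->
  act (last_to M j) (M.+1, x) = (j, x).
Proof.
move: j; apply: down_ind => [|j jM IHj]; first by rewrite last_to_max (sb_act1 D).
by rewrite last_toS // (sb_actM D) IHj (sb_act_sg D) ?marked_act_down.
Qed.

Lemma sb_act_push_gen j x : (j <= M)%N ->
  act (push_gen M j) (M.+1, x) = (M.+1, a j x).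
Proof.
move=> jM; rewrite push_genE !(sb_actM D) sb_act_last_to //.
rewrite !(sb_act_sg D) // marked_act_down // marked_act_up //.
by rewrite -(@sb_act_last_to j.+1 (a j x)) // (sb_actK D).
Qed.

Lemma sb_act_pushes w x : all (fun l => l.1 <= M)%N w ->
  act (word_val (push_gen M) w) (M.+1, x) = (M.+1, word_act a a' w x).
Proof.
rewrite /word_val; elim: w x => [|[j b] w IHw] x /=.
  by rewrite big_nil (sb_act1 D).
case/andP=> jM /IHw {}IHw; rewrite big_cons (sb_actM D) /=.
case: b => /=; last by rewrite sb_act_push_gen // IHw.
rewrite -{1}(ms_a'K D jM x) -sb_act_push_gen // (sb_actK D).
exact: IHw.
Qed.

Lemma sb_act_lift_word u x :
  act (lift_word u) (M.+1, x) =
  (M.+1, word_act (fun i : 'I_M => s i) (fun i : 'I_M => s' i) u x).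
Proof.
have Hs (i : 'I_M) y : act (sg M.+2 i) (M.+1, y) = (M.+1, s i y).
  have iM := ltn_ord i.
  by rewrite (sb_act_sg D) ?marked_act_hi ?ltnS ?iM //= ltnW.
rewrite /lift_word /word_val; elim: u x => [|[i b] u IHu] x /=.
  by rewrite big_nil (sb_act1 D).
rewrite big_cons (sb_actM D) /=; case: b => /=; last by rewrite Hs IHu.
by rewrite -{1}(ms_s'K D (ltn_ord i) x) -Hs (sb_actK D) IHu.
Qed.

End MarkedActionOnPushes.

(** * Undetected elements and removal of the last strand *)

Definition undetected n (g : sphere_braid_group n) : Prop :=
  forall m, @vassiliev_filtration n m (gr_elt g - 1)%R.

Lemma singular_ideal_ideal n : two_sided_ideal (singular_ideal n).
Proof. exact: ideal_gen_ideal. Qed.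

Lemma vassiliev_filtration_ideal n m :
  two_sided_ideal (@vassiliev_filtration n m).
Proof. exact/ideal_pow_ideal/singular_ideal_ideal. Qed.

Lemma singular_ideal_sg n i : (i < n.-1)%N ->
  singular_ideal n (gr_elt (sg n i) - gr_elt (sg n i)^-1)%R.
Proof.
move=> iN; apply: sub_gen_smallest; exists (Ordinal iN).
by rewrite (sgE (Ordinal iN)).
Qed.

(** The trivial action on a point gives the augmentation of the group ring: it kills every generator
    of W but not 1. *)
Lemma one_notin_singular_ideal n : ~ singular_ideal n 1%R.
Proof.
pose E k (h : unit -> int) := k = 0%N \/ h = fun=> 0%R.
pose f (_ : 'I_n.-1) := @id unit.
have act_eq u v x : word_act f f u x = word_act f f v x.
  by case: (word_act f f u x); case: (word_act f f v x).
have E0 k : E k (fun=> 0%R) by right.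
have EB k h h' : E k h -> E k h' -> E k (fun x => h x - h' x)%R.
  move=> [->|->] [|->]; try by left.
  by right; apply/funext => x; rewrite subrr.
have Ed k h (c : 'I_n.-1) : E k h -> E k.+1 (fun x => h (f c x) - h (f c x))%R.
  by move=> _; right; apply/funext => x; rewrite subrr.
have Ef k h (c : 'I_n.-1) : E k h -> E k (h \o f c) by [].
move=> H1; have E1 : E 0%N (fun=> 1%R) by left.
have := singular_ideal_filtration (fun _ _ => erefl) (fun _ _ => erefl)
  (fun u v _ => act_eq u v) E0 EB Ef Ef Ed H1 E1.
case=> // /(congr1 (@^~ tt)).
by rewrite /gr_act -gr_elt1 gr_extend_elt.
Qed.

Section StrandRemoval.
Variable M : nat.
Local Notation G' := (sphere_braid_group M.+1).
Let s k (x : G') := x * sg M.+1 k.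
Let s' k (x : G') := x / sg M.+1 k.
Let a (_ : nat) := @id G'.

(** The model of forgetting the marked strand: its loops act trivially and the other strands act by
    right multiplication on their own braid group. *)
Lemma removal_system : marked_system M s s' a a.
Proof.
have foldP t x : foldl (fun y k => s k y) x t = x * \prod_(k <- t) sg M.+1 k.
  by elim: t x => [|k t IHt] x; rewrite ?big_nil ?mulg1 //= big_cons IHt mulgA.
split=> //.
- by move=> k _ x; rewrite /s /s' mulgK.
- by move=> k _ x; rewrite /s /s' mulgVK.
- by move=> i j ij x; rewrite /s -!mulgA (sg_far (n := M.+1) ij).
- by move=> i iM x; rewrite /s -!mulgA (sg_near (n := M.+1) iM).
- by move=> x; elim: (iota _ _).
- by move=> x; rewrite /a !foldP -mulgA -[M]/(M.+1.-1) sg_sphere mulg1.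
Qed.

Lemma removal_lift_word u x :
  sb_act s s' a a (lift_word u) (M.+1, x) =
  (M.+1, x * pg_class (@sphere_braid_rel M.+1) u).
Proof.
rewrite (sb_act_lift_word removal_system) pg_class_sg /word_val.
congr pair; elim: u x => [|[i b] u IHu] x; first by rewrite big_nil mulg1.
by rewrite big_cons mulgA -IHu; case: b.
Qed.

(** In the decomposition of [x], a return to the last position forces [last_to j] to be trivial, and
    a trivial image makes the word [u] trivial with one strand less, so that its lift is itself a
    product of loops. *)
Lemma pushes_removal (x : sphere_braid_group M.+2) :
  (exists y, sb_act s s' a a x (M.+1, 1) = (M.+1, y) /\ y = 1) -> pushes x.
Proof.
case: (lift_last_to_decomposition x) => nu [u [j [[w Hw ->] jM ->]]] [y []].
rewrite !(sb_actM removal_system) (sb_act_pushes removal_system) //.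
have -> : word_act a a w 1 = 1 by elim: w {Hw} => [|[i []] w IHw].
rewrite removal_lift_word mul1g (sb_act_last_to removal_system) // => -[-> <-].
rewrite last_to_max mulg1 => Hu; apply: pushesM; first by exists w.
have /lift_word_eq : word_eq (@sphere_braid_rel M.+1) u [::].
  by apply/pg_classP; rewrite Hu.
by rewrite /lift_word [word_val _ [::]]big_nil invg1 mulg1.
Qed.

(** The test function [h] is the identity inclusion at the last position and 0 elsewhere. Its
    variation under [g] lies in every W^m; if [g] moved the last position, this variation at 1 would
    be -1, which is not in W. *)
Lemma undetected_removal g : @undetected M.+2 g ->
  exists2 y, sb_act s s' a a g (M.+1, 1) = (M.+1, y) & undetected y.
Proof.
move=> Hg.
(* Degree [k] means being a right multiplication by an element of W^k; translating the argument by a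
   generator multiplies [z] on the left. *)
pose E k (h : G' -> group_ring G') := exists2 z,
  @vassiliev_filtration M.+1 k z & h = fun x => (gr_elt x * z)%R.
have HI k := @vassiliev_filtration_ideal M.+1 k.
have EM y k z : @vassiliev_filtration M.+1 k z ->
    E k (fun x => gr_elt (x * y) * z)%R.
  move=> Hz; exists (gr_elt y * z)%R; first exact: ((HI k).2 (gr_elt y) z Hz).1.
  by apply/funext => x; rewrite gr_eltM mulrA.
pose h (p : nat * G') : group_ring G' := if p.1 == M.+1 then gr_elt p.2 else 0%R.
have E0 k : E k (fun=> 0%R).
  by exists 0%R; [exact: (HI k).1.1|apply/funext => x; rewrite mulr0].
have Hm m : @vassiliev_filtration M.+1 m
    (h (sb_act s s' a a g (M.+1, 1%g)) - 1)%R.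
  have := @undetected_marked_act _ _ _ _ _ _ removal_system _ E E0 _ _ _ _ _ _ _ _
    g 0%N h Hg _ m M.+1.
  case=> //.
  + move=> k h1 h2 [z1 Hz1 ->] [z2 Hz2 ->]; exists (z1 - z2)%R.
      exact: (HI k).1.2.
    by apply/funext => x; rewrite mulrBr.
  + by move=> k h1 i _ [z Hz ->]; apply: EM.
  + by move=> k h1 i _ [z Hz ->]; apply: EM.
  + move=> k h1 i iM [z Hz ->]; exists ((gr_elt (sg M.+1 i) - gr_elt (sg M.+1 i)^-1) * z)%R.
      by apply: ideal_pow_mull => //; [exact: singular_ideal_ideal|exact: singular_ideal_sg].
    have sandwichB (R : nzRingType) (u b c t : R) :
        (u * b * t - u * c * t = u * ((b - c) * t))%R.
      by rewrite mulrBl mulrBr !mulrA.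
    by apply/funext => x; rewrite /s /s' !gr_eltM sandwichB.
  + by move=> k h1 i iM _; have := E0 k.+1; congr E; apply/funext => x; rewrite subrr.
  + by move=> k h1 i iM _; have := E0 k.+1; congr E; apply/funext => x; rewrite subrr.
  + move=> j; rewrite /h /=; case: eqVneq => _; last exact: E0.
    by exists 1%R => //; apply/funext => x; rewrite mulr1.
  move=> z Hz /(congr1 (@^~ 1)); rewrite gr_elt1 mul1r /h /= eqxx gr_elt1 => ->.
  exact: Hz.
case Eg : (sb_act s s' a a g (M.+1, 1)) Hm => [j y] Hm.
have [Ej|jM] := eqVneq j M.+1.
  by exists y; [rewrite Ej|move=> m; have := Hm m; rewrite /h /= Ej eqxx].
have := Hm 1%N; rewrite /h /= (negPf jM) sub0r => Hm1.
have I1 := singular_ideal_ideal M.+1; case: (@one_notin_singular_ideal M.+1).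
rewrite -(opprK 1%R); apply: additive_subgroupN I1.1 _.
move: Hm1; apply: ideal_mul_ind I1.1 _ _ => x z _ Hz.
by have [] := I1.2 x z Hz.
Qed.

End StrandRemoval.

(** * The action on systems of loops around the punctures *)

Ltac nat_cases := repeat match goal with
  | |- context [@eq_op _ ?a ?b] =>
      let H := fresh "H" in
      have [H|H] := @eqVneq nat a b;
      try (exfalso; lia); try subst; rewrite /=
  end.

Section Hurwitz.
Variable Q : groupType.
Implicit Types (y : nat -> Q) (z : Q).

Fixpoint prefix_prod y l : Q := if l is l'.+1 then prefix_prod y l' * y l' else 1.

(** The Hurwitz move [(a, b) |-> (b, a ^ b)] on neighbouring entries; it keeps the ordered product
    because [b * a ^ b = a * b]. *)
Definition hurwitz k y i : Q :=
  if i == k then y k.+1 else if i == k.+1 then y k ^ y k.+1 else y i.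

Definition hurwitz' k y i : Q :=
  if i == k then y k.+1 ^ (y k)^-1 else if i == k.+1 then y k else y i.

Definition conj_all z y i : Q := y i ^ z.

Lemma eq_prefix_prod y y' l :
  (forall i, (i < l)%N -> y i = y' i) -> prefix_prod y l = prefix_prod y' l.
Proof.
elim: l => //= l IHl Hy; rewrite IHl ?Hy // => i il; apply: Hy; exact: leqW.
Qed.

Lemma hurwitzK k : cancel (hurwitz k) (hurwitz' k).
Proof.
move=> y; apply/funext => i; rewrite /hurwitz' /hurwitz; nat_cases => //.
by rewrite conjgK.
Qed.

Lemma hurwitz'K k : cancel (hurwitz' k) (hurwitz k).
Proof.
move=> y; apply/funext => i; rewrite /hurwitz' /hurwitz; nat_cases => //.
by rewrite conjgKV.
Qed.

Lemma hurwitz_far j k y : (j.+1 < k)%N ->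
  hurwitz j (hurwitz k y) = hurwitz k (hurwitz j y).
Proof.
by move=> jk; apply/funext => i; rewrite /hurwitz; nat_cases.
Qed.

Lemma hurwitz_near k y :
  hurwitz k (hurwitz k.+1 (hurwitz k y)) =
  hurwitz k.+1 (hurwitz k (hurwitz k.+1 y)).
Proof.
apply/funext => i; rewrite /hurwitz; nat_cases => //.
by rewrite conjJg.
Qed.

Lemma hurwitz_conj_all k z y :
  hurwitz k (conj_all z y) = conj_all z (hurwitz k y).
Proof.
by apply/funext => i; rewrite /hurwitz /conj_all; nat_cases; rewrite -?conjJg.
Qed.

Lemma conj_allM z z' y : conj_all z' (conj_all z y) = conj_all (z * z') y.
Proof. by apply/funext => i; rewrite /conj_all conjgM. Qed.

Lemma conj_all1 y : conj_all 1 y = y.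
Proof. by apply/funext => i; rewrite /conj_all conjg1. Qed.

Lemma prefix_prod_conj_all z y l :
  prefix_prod (conj_all z y) l = prefix_prod y l ^ z.
Proof. by elim: l => [|l IHl] /=; rewrite ?conj1g // IHl conjMg. Qed.

Lemma prefix_prod_hurwitz k y l : (k.+1 < l)%N ->
  prefix_prod (hurwitz k y) l = prefix_prod y l.
Proof.
elim: l => // l IHl; rewrite ltnS leq_eqVlt => /orP [/eqP <-|kl] /=; last first.
  by rewrite IHl // /hurwitz; nat_cases.
rewrite (@eq_prefix_prod _ y) => [|i ik]; last by rewrite /hurwitz; nat_cases.
by rewrite /hurwitz; nat_cases; rewrite conjgE -!mulgA mulVKg.
Qed.

Lemma prefix_prod_hurwitz' k y l : (k.+1 < l)%N ->
  prefix_prod (hurwitz' k y) l = prefix_prod y l.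
Proof.
by move=> kl; rewrite -(prefix_prod_hurwitz (hurwitz' k y) kl) hurwitz'K.
Qed.

Definition conj_by j y := conj_all (y j)^-1 y.
Definition conj_by' j y := conj_all (y j) y.

Lemma conj_byK j : cancel (conj_by j) (conj_by' j).
Proof.
move=> y; rewrite /conj_by' /conj_by conj_allM /conj_all -[RHS]conj_all1.
by rewrite conjgE invgK mulKg mulgV.
Qed.

Lemma conj_by'K j : cancel (conj_by' j) (conj_by j).
Proof.
move=> y; rewrite /conj_by' /conj_by conj_allM /conj_all -[RHS]conj_all1.
by rewrite conjgE mulKg mulgV.
Qed.

Lemma conj_by2 j l y : conj_by l (conj_by j y) = conj_all (y j * y l)^-1 y.
Proof.
rewrite /conj_by conj_allM; congr (conj_all _ _).
by rewrite /conj_all conjgE invgK !invgM invgK !mulgA mulVg mul1g.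
Qed.

Lemma fold_conj_by l y :
  foldl (fun y j => conj_by j y) y (iota 0 l) = conj_all (prefix_prod y l)^-1 y.
Proof.
elim: l => [|l IHl]; first by rewrite /= invg1 conj_all1.
rewrite -addn1 iotaD foldl_cat IHl /= addn1 /conj_by conj_allM add0n /=.
by rewrite /conj_all conjgE invgK !invgM invgK !mulgA mulVg mul1g.
Qed.

(** Each letter conjugates by an entry that the earlier letters have already conjugated. This
    reverses the order of composition, so the total conjugator is read off from the original
    tuple. *)
Lemma word_act_conj_by w y :
  word_act conj_by conj_by' w y = conj_all (word_val y w)^-1 y.
Proof.
rewrite /word_val; elim/last_ind: w => [|w [j b] IHw].
  by rewrite big_nil invg1 conj_all1.
rewrite -cats1 word_act_cat IHw big_cat big_seq1 /=; set z := \prod_(l <- w) _.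
have E : conj_all z^-1 y j = z * y j / z by rewrite /conj_all conjgE invgK mulgA.
case: b => /=; rewrite ?/conj_by ?/conj_by' conj_allM E.
  by rewrite -mulgA mulKg invgM invgK.
by rewrite !invgM invgK !mulgA mulVg mul1g.
Qed.

(** The first entry travels to place [l] and is conjugated by every entry it passes. The factor
    [y 0] in the prefix product changes nothing, since [y 0] commutes with itself. *)
Lemma fold_hurwitz_up l y :
  foldl (fun y k => hurwitz k y) y (iota 0 l) =
  fun i => if (i < l)%N then y i.+1 else
           if i == l then y 0%N ^ prefix_prod y l.+1 else y i.
Proof.
elim: l => [|l IHl].
  by apply/funext => -[|i] //=; rewrite mul1g conjgE mulKg.
rewrite -addn1 iotaD foldl_cat IHl /= addn1 add0n; apply/funext => i.
rewrite /hurwitz ltnn eqxx [(l.+1 < l)%N]ltnNge leqW //= [l.+1 == l]gtn_eqF //.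
have [->|ne] := eqVneq i l; first by rewrite ltnS leqnn.
have [->|ne'] := eqVneq i l.+1; first by rewrite ltnn -conjgM.
by rewrite ltnS [(i <= l)%N]leq_eqVlt (negPf ne).
Qed.

Lemma fold_hurwitz_down l y :
  foldl (fun y k => hurwitz k y) y (rev (iota 0 l)) =
  fun i => if i == 0%N then y l else if (i <= l)%N then y i.-1 ^ y l else y i.
Proof.
elim: l y => [|l IHl] y; first by apply/funext => -[|i].
rewrite -addn1 iotaD rev_cat /= IHl addn1 add0n; apply/funext => -[|i] /=.
  by rewrite /hurwitz eqxx.
rewrite /hurwitz eqxx eqSS !ltnS.
by have [il|li|->] := ltngtP i l; rewrite ?eqxx //; nat_cases.
Qed.

(** As the total product is 1, [y 0] arrives at place [M] unchanged. The loop move then conjugates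
    everything by its inverse, and the way back conjugates the passed entries by [y 0] again. *)
Lemma fold_hurwitz_sphere M y : prefix_prod y M.+1 = 1 ->
  (forall i, (M < i)%N -> y i = 1) ->
  foldl (fun y k => hurwitz k y)
    (conj_by M (foldl (fun y k => hurwitz k y) y (iota 0 M))) (rev (iota 0 M)) = y.
Proof.
move=> y1 yM; rewrite fold_hurwitz_up y1 conjg1 fold_hurwitz_down.
apply/funext => i; rewrite /conj_by /conj_all ltnn eqxx.
have E : y 0%N ^ (y 0%N)^-1 = y 0%N by rewrite conjgE mulgV mulg1 invgK.
case: i => [|i] /=; first by [].
have [iM|Mi] := ltnP i M; first by rewrite E conjgKV.
by rewrite ltnNge leqW //= gtn_eqF // yM // conj1g.
Qed.

End Hurwitz.

Section Loops.
Variables (M : nat) (Q : groupType).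

(** Tuples of length [M.+1] are functions equal to 1 beyond [M]: simultaneous conjugation fixes that
    tail, so relations hold as equalities of functions. *)
Definition loop_system (y : nat -> Q) : bool :=
  `[< prefix_prod y M.+1 = 1 /\ forall i, (M < i)%N -> y i = 1 >].

Definition loops : Type := {y : nat -> Q | loop_system y}.

Lemma loops_prod (y : loops) : prefix_prod (val y) M.+1 = 1.
Proof. by have /asboolP [] := valP y. Qed.

Lemma loops_out (y : loops) i : (M < i)%N -> val y i = 1.
Proof. by have /asboolP [_] := valP y; apply. Qed.

(** The default [y] is returned only if [f k] leaves the set of loop systems, which does not happen
    for the conjugations, nor for the Hurwitz moves with [k < M]. *)
Definition on_loops (f : nat -> (nat -> Q) -> nat -> Q) k (y : loops) : loops :=
  insubd y (f k (val y)).

Definition loops_s := on_loops (@hurwitz Q).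
Definition loops_s' := on_loops (@hurwitz' Q).
Definition loops_a := on_loops (@conj_by Q).
Definition loops_a' := on_loops (@conj_by' Q).

Lemma val_loops_s k y : (k < M)%N -> val (loops_s k y) = hurwitz k (val y).
Proof.
move=> kM; rewrite val_insubd /loop_system; case: asboolP => // H; case: H; split=> [|i iM].
  by rewrite prefix_prod_hurwitz ?loops_prod.
by rewrite /hurwitz; nat_cases; rewrite loops_out.
Qed.

Lemma val_loops_s' k y : (k < M)%N -> val (loops_s' k y) = hurwitz' k (val y).
Proof.
move=> kM; rewrite val_insubd /loop_system; case: asboolP => // H; case: H; split=> [|i iM].
  by rewrite prefix_prod_hurwitz' ?loops_prod.
by rewrite /hurwitz'; nat_cases; rewrite loops_out.
Qed.

Lemma val_loops_a k y : val (loops_a k y) = conj_by k (val y).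
Proof.
rewrite val_insubd /loop_system; case: asboolP => // H; case: H; split=> [|i iM].
  by rewrite prefix_prod_conj_all loops_prod conj1g.
by rewrite /conj_by /conj_all loops_out // conj1g.
Qed.

Lemma val_loops_a' k y : val (loops_a' k y) = conj_by' k (val y).
Proof.
rewrite val_insubd /loop_system; case: asboolP => // H; case: H; split=> [|i iM].
  by rewrite prefix_prod_conj_all loops_prod conj1g.
by rewrite /conj_by' /conj_all loops_out // conj1g.
Qed.

Lemma val_fold_loops_s t y : all (fun k => k < M)%N t ->
  val (foldl (fun y k => loops_s k y) y t) =
  foldl (fun y k => hurwitz k y) (val y) t.
Proof. by elim: t y => //= k t IHt y /andP [kM /IHt ->]; rewrite val_loops_s. Qed.

Lemma val_word_act_loops w y :
  val (word_act loops_a loops_a' w y) =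
  word_act (@conj_by Q) (@conj_by' Q) w (val y).
Proof.
elim: w y => // -[j b] w IHw y /=; rewrite IHw.
by case: b; rewrite ?val_loops_a ?val_loops_a'.
Qed.

(** Hurwitz moves commute with simultaneous conjugation, so the mixed relations only record where a
    move sends the conjugating entry. *)
Lemma loops_system : marked_system M loops_s loops_s' loops_a loops_a'.
Proof.
have Ht : all (fun k => k < M)%N (iota 0 M).
  by apply/allP => k; rewrite mem_iota add0n.
split.
- by move=> k kM y; apply: val_inj; rewrite val_loops_s' ?val_loops_s ?hurwitzK.
- by move=> k kM y; apply: val_inj; rewrite val_loops_s ?val_loops_s' ?hurwitz'K.
- by move=> k _ y; apply: val_inj; rewrite val_loops_a' val_loops_a conj_byK.
- by move=> k _ y; apply: val_inj; rewrite val_loops_a val_loops_a' conj_by'K.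
- move=> i j /andP [ij jM] y; apply: val_inj.
  by rewrite !val_loops_s 1?hurwitz_far //; lia.
- by move=> i iM y; apply: val_inj; rewrite !val_loops_s 1?hurwitz_near //; lia.
- move=> k j kM _ jk jk1 y; apply: val_inj.
  rewrite val_loops_a !val_loops_s // val_loops_a /conj_by hurwitz_conj_all.
  by rewrite {1}/hurwitz (negPf jk) (negPf jk1).
- move=> k kM y; apply: val_inj.
  rewrite val_loops_a !val_loops_s // val_loops_a /conj_by hurwitz_conj_all.
  by rewrite {1}/hurwitz eqxx.
- move=> k kM y; apply: val_inj.
  rewrite !val_loops_a !val_loops_s // !val_loops_a !conj_by2 hurwitz_conj_all.
  by congr (conj_all _ _); rewrite /hurwitz; nat_cases; rewrite conjgE mulVKg.
- move=> y; apply: val_inj.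
  have -> t : val (foldl (fun y j => loops_a j y) y t) =
      foldl (fun y j => conj_by j y) (val y) t.
    by elim: t y => //= j t IHt y; rewrite IHt val_loops_a.
  by rewrite fold_conj_by loops_prod invg1 conj_all1.
- move=> y; apply: val_inj; rewrite val_fold_loops_s ?all_rev //.
  rewrite val_loops_a val_fold_loops_s // fold_hurwitz_sphere ?loops_prod //.
  exact: loops_out.
Qed.

End Loops.

Local Open Scope ring_scope.

(** * The augmentation filtration on functions of a loop system *)

Section LoopFiltration.
Variables (M : nat) (Q : groupType) (R : nzRingType) (rho : Q -> R).
Hypothesis rho1 : rho 1%g = 1.
Hypothesis rhoM : forall x y, rho (x * y)%g = rho x * rho y.
Local Notation T := (loops M Q).

(* The filtration of the ring of functions spanned by the entries of a loop
   system by the powers of its augmentation ideal. *)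
Inductive loop_filtration : nat -> (T -> R) -> Prop :=
| loop_filtration0 k : loop_filtration k (fun=> 0)
| loop_filtration1 : loop_filtration 0 (fun=> 1)
| loop_filtration_var i : loop_filtration 1 (fun y => rho (val y i) - 1)
| loop_filtration_varV i : loop_filtration 1 (fun y => rho (val y i)^-1%g - 1)
| loop_filtrationB k h h' : loop_filtration k h -> loop_filtration k h' ->
    loop_filtration k (fun y => h y - h' y)
| loop_filtrationM k l h h' : loop_filtration k h -> loop_filtration l h' ->
    loop_filtration (k + l) (fun y => h y * h' y)
| loop_filtrationW k h : loop_filtration k.+1 h -> loop_filtration k h.

Local Notation E := loop_filtration.

Lemma loop_filtrationD k h h' : E k h -> E k h' -> E k (fun y => h y + h' y).
Proof.
move=> Eh Eh'.
have := loop_filtrationB Eh (loop_filtrationB (loop_filtration0 k) Eh').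
by congr E; apply/funext => y; rewrite sub0r opprK.
Qed.

Definition loop_word (phi : T -> Q) : Prop :=
  E 1 (fun y => rho (phi y) - 1) /\ E 1 (fun y => rho (phi y)^-1%g - 1).

Lemma loop_word_var i : loop_word (fun y => val y i).
Proof. by split; [exact: loop_filtration_var|exact: loop_filtration_varV]. Qed.

Lemma loop_wordV phi : loop_word phi -> loop_word (fun y => (phi y)^-1%g).
Proof.
move=> [E1 E2]; split => //; move: E1; congr E.
by apply/funext => y; rewrite invgK.
Qed.

Lemma loop_word0 phi : loop_word phi -> E 0 (fun y => rho (phi y)).
Proof.
move=> [/loop_filtrationW E1 _]; have := loop_filtrationD E1 loop_filtration1.
by congr E; apply/funext => y; rewrite subrK.
Qed.

Lemma loop_wordM phi psi : loop_word phi -> loop_word psi ->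
  loop_word (fun y => phi y * psi y)%g.
Proof.
move=> Wphi Wpsi; split.
  have := loop_filtrationD (loop_filtrationM Wphi.1 (loop_word0 Wpsi)) Wpsi.1.
  by congr E; apply/funext => y; rewrite mulrBl mul1r rhoM addrA subrK.
have := loop_filtrationD (loop_filtrationM Wpsi.2 (loop_word0 (loop_wordV Wphi))) Wphi.2.
by congr E; apply/funext => y; rewrite mulrBl mul1r invgM rhoM addrA subrK.
Qed.

Lemma loop_wordJ phi psi : loop_word phi -> loop_word psi ->
  loop_word (fun y => phi y ^ psi y)%g.
Proof.
move=> Wphi Wpsi; apply: loop_wordM; first exact: loop_wordV.
exact: loop_wordM.
Qed.

(** Agreement modulo degree 2, required of the inverses too because they are also among the
    generators of the filtration. *)
Definition loop_close (phi psi : T -> Q) : Prop :=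
  E 2 (fun y => rho (phi y) - rho (psi y)) /\
  E 2 (fun y => rho (phi y)^-1%g - rho (psi y)^-1%g).

Lemma loop_close_refl phi : loop_close phi phi.
Proof.
by split; have := loop_filtration0 2; congr E; apply/funext => y; rewrite subrr.
Qed.

Lemma loop_close_sym phi psi : loop_close phi psi -> loop_close psi phi.
Proof.
move=> [E1 E2].
split; [have := loop_filtrationB (loop_filtration0 2) E1|
        have := loop_filtrationB (loop_filtration0 2) E2];
  by congr E; apply/funext => y; rewrite sub0r opprB.
Qed.

(** For invertible [a] and [b], [b^-1 a b - a = b^-1 ((a - 1)(b - 1) - (b - 1)(a - 1))], and both
    products on the right have degree 2. *)
Lemma loop_closeJ phi psi : loop_word phi -> loop_word psi ->
  loop_close (fun y => phi y ^ psi y)%g phi.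
Proof.
have H chi omega : loop_word chi -> loop_word omega ->
    E 2 (fun y => rho (chi y ^ omega y)%g - rho (chi y)).
  move=> Wc Wo; have := loop_filtrationM (loop_word0 (loop_wordV Wo))
    (loop_filtrationB (loop_filtrationM Wc.1 Wo.1) (loop_filtrationM Wo.1 Wc.1)).
  congr E; apply/funext => y; rewrite conjgE !rhoM.
  have cb : rho (omega y)^-1%g * rho (omega y) = 1 by rewrite -rhoM mulVg.
  move: (rho (chi y)) (rho (omega y)) (rho (omega y)^-1%g) cb => a b c cb.
  have -> : (a - 1) * (b - 1) - (b - 1) * (a - 1) = a * b - b * a.
    have H u v : (u - 1) * (v - 1) = u * v - (u + v - 1) :> R.
      by rewrite mulrBl mulrBr mul1r mulr1 -[u * v - u - _]addrA -opprD addrA.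
    by rewrite !H (addrC b a); move: (a + b - 1) => e; rewrite opprB addrA subrK.
  by rewrite mulrBr (mulrA c b) cb mul1r.
move=> Wphi Wpsi; split; first exact: H.
have := H _ _ (loop_wordV Wphi) Wpsi; congr E.
by apply/funext => y; rewrite conjVg.
Qed.

Lemma loop_filtration_comp (F : T -> T) k h :
  (forall i, loop_word (fun y => val (F y) i)) -> E k h -> E k (h \o F).
Proof.
move=> WF; elim=> {k h} [k||i|i|k h h' _ IH _ IH'|k l h h' _ IH _ IH'|k h _ IH].
- exact: loop_filtration0.
- exact: loop_filtration1.
- by have [] := WF i.
- by have [] := WF i.
- exact: loop_filtrationB.
- exact: loop_filtrationM.
exact: loop_filtrationW.
Qed.

(** Closeness of the entries gains one degree on the generators, and the gain passes to products
    through [a b - a' b' = (a - a') b + a' (b - b')]. *)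
Lemma loop_filtration_diff (F F' : T -> T) k h :
  (forall i, loop_word (fun y => val (F y) i)) ->
  (forall i, loop_word (fun y => val (F' y) i)) ->
  (forall i, loop_close (fun y => val (F y) i) (fun y => val (F' y) i)) ->
  E k h -> E k.+1 (fun y => h (F y) - h (F' y)).
Proof.
move=> WF WF' C; elim=> {k h} [k||i|i|k h h' _ IH _ IH'|k l h h' Eh IH Eh' IH'|k h _ IH].
- by have := loop_filtration0 k.+1; congr E; apply/funext => y; rewrite subrr.
- by have := loop_filtration0 1; congr E; apply/funext => y; rewrite subrr.
- have [+ _] := C i; congr E; apply/funext => y.
  by rewrite opprB addrA subrK.
- have [_ +] := C i; congr E; apply/funext => y.
  by rewrite opprB addrA subrK.
- have := loop_filtrationB IH IH'; congr E; apply/funext => y.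
  move: (h _) (h _) (h' _) (h' _) => a b c e.
  by rewrite !opprB -!addrA; congr (_ + _); rewrite addrCA [RHS]addrCA (addrC (- a)).
- have H1 := loop_filtrationM IH (loop_filtration_comp WF Eh').
  have H2 := loop_filtrationM (loop_filtration_comp WF' Eh) IH'.
  rewrite addnS -addSn in H2.
  have := loop_filtrationD H1 H2; rewrite addSn; congr E; apply/funext => y /=.
  by rewrite mulrBl mulrBr addrA subrK.
exact: loop_filtrationW.
Qed.

Section Nilpotent.
Variables (J : nat -> R -> Prop) (d : nat).
Hypothesis J0 : forall k, J k 0.
Hypothesis J1 : J 0 1.
Hypothesis Jrho : forall q, J 1 (rho q - 1).
Hypothesis JB : forall k x y, J k x -> J k y -> J k (x - y).
Hypothesis JM : forall k l x y, J k x -> J l y -> J (k + l) (x * y).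
Hypothesis JW : forall k x, J k.+1 x -> J k x.
Hypothesis Jd : forall x, J d x -> x = 0.

(** [J] is a multiplicative filtration of the target ring that reaches 0 and gives each [rho q - 1]
    degree 1, so evaluation at a loop system respects degrees. *)
Lemma loop_filtration_nilpotent k h y : E k h -> J k (h y).
Proof. by elim=> {k h} *; auto. Qed.

(** A crossing and its inverse give entries that differ by conjugations, hence are close, so the
    filtration argument applies. A word in the loops acts by conjugation by its value, and
    invariance of the entry [rho (y i)] says that the two images commute. *)
Lemma undetected_pushes_commute w (y : T) i :
  all (fun l => l.1 <= M)%N w -> undetected (word_val (push_gen M) w) ->
  rho (word_val (val y) w) * rho (val y i) =
  rho (val y i) * rho (word_val (val y) w).
Proof.
move=> Hw Hg; have D := loops_system M Q.
have WVar j := loop_word_var j.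
have Ws k i0 : (k < M)%N -> loop_word (fun y => val (loops_s k y) i0).
  move=> kM; have [E1|] := eqVneq i0 k.
    have := WVar k.+1; congr loop_word; apply/funext => z.
    by rewrite val_loops_s // /hurwitz E1 eqxx.
  have [E1 _|ne1 ne2] := eqVneq i0 k.+1.
    have := loop_wordJ (WVar k) (WVar k.+1); congr loop_word; apply/funext => z.
    by rewrite val_loops_s // /hurwitz E1; nat_cases.
  have := WVar i0; congr loop_word; apply/funext => z.
  by rewrite val_loops_s // /hurwitz (negPf ne1) (negPf ne2).
have Ws' k i0 : (k < M)%N -> loop_word (fun y => val (loops_s' k y) i0).
  move=> kM; have [E1|] := eqVneq i0 k.
    have := loop_wordJ (WVar k.+1) (loop_wordV (WVar k)).
    congr loop_word; apply/funext => z.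
    by rewrite val_loops_s' // /hurwitz' E1 eqxx.
  have [E1 _|ne1 ne2] := eqVneq i0 k.+1.
    have := WVar k; congr loop_word; apply/funext => z.
    by rewrite val_loops_s' // /hurwitz' E1; nat_cases.
  have := WVar i0; congr loop_word; apply/funext => z.
  by rewrite val_loops_s' // /hurwitz' (negPf ne1) (negPf ne2).
have Ea j i0 : (fun y : T => val (loops_a j y) i0) =
    (fun y => val y i0 ^ (val y j)^-1)%g.
  by apply/funext => z; rewrite val_loops_a.
have Ea' j i0 : (fun y : T => val (loops_a' j y) i0) =
    (fun y => val y i0 ^ (val y j))%g.
  by apply/funext => z; rewrite val_loops_a'.
have Wa j i0 : loop_word (fun y => val (loops_a j y) i0).
  by rewrite Ea; apply: loop_wordJ => //; apply: loop_wordV.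
have Wa' j i0 : loop_word (fun y => val (loops_a' j y) i0).
  by rewrite Ea'; apply: loop_wordJ.
(* The test function is the [i]-th entry, read at the last position; it has degree 0, so its
   variation has degree [d] and vanishes in the ring. *)
pose h (p : nat * T) := if p.1 == M.+1 then rho (val p.2 i) else 0.
have Eh j : E 0 (fun y => h (j, y)).
  rewrite /h /=; case: eqP => _; last exact: loop_filtration0.
  exact: (loop_word0 (loop_word_var i)).
have Cs k i0 : (k < M)%N ->
    loop_close (fun y => val (loops_s k y) i0) (fun y => val (loops_s' k y) i0).
  move=> kM; have [E1|] := eqVneq i0 k.
    have := loop_close_sym (loop_closeJ (WVar k.+1) (loop_wordV (WVar k))).
    congr loop_close; apply/funext => z.
      by rewrite val_loops_s // /hurwitz E1 eqxx.
    by rewrite val_loops_s' // /hurwitz' E1 eqxx.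
  have [E1 _|ne1 ne2] := eqVneq i0 k.+1.
    have := loop_closeJ (WVar k) (WVar k.+1).
    congr loop_close; apply/funext => z.
      by rewrite val_loops_s // /hurwitz E1; nat_cases.
    by rewrite val_loops_s' // /hurwitz' E1; nat_cases.
  have := loop_close_refl (fun y => val y i0).
  congr loop_close; apply/funext => z.
    by rewrite val_loops_s // /hurwitz (negPf ne1) (negPf ne2).
  by rewrite val_loops_s' // /hurwitz' (negPf ne1) (negPf ne2).
have Ca j i0 : loop_close (fun y => val (loops_a j y) i0) (fun y => val y i0).
  by rewrite Ea; apply: loop_closeJ => //; apply: loop_wordV.
have Ca' j i0 : loop_close (fun y => val y i0) (fun y => val (loops_a' j y) i0).
  by rewrite Ea'; apply/loop_close_sym/loop_closeJ.
have := undetected_marked_act D loop_filtration0 loop_filtrationB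
  (fun k h0 j jM => loop_filtration_comp (fun i => Ws j i jM))
  (fun k h0 j jM => loop_filtration_comp (fun i => Ws' j i jM))
  (fun k h0 j jM => loop_filtration_comp (Wa j))
  (fun k h0 j jM => loop_filtration_comp (Wa' j))
  (fun k h0 j jM => loop_filtration_diff (fun i => Ws j i jM)
     (fun i => Ws' j i jM) (fun i => Cs j i jM))
  (fun k h0 j jM => loop_filtration_diff (Wa j) WVar (Ca j))
  (fun k h0 j jM => loop_filtration_diff WVar (Wa' j) (Ca' j))
  Hg Eh d M.+1.
move=> /(loop_filtration_nilpotent y) /Jd /=.
rewrite sb_act_pushes // /h /= eqxx => /eqP; rewrite subr_eq0 => /eqP.
rewrite val_word_act_loops word_act_conj_by /conj_all; move: (word_val _ w) => z.
rewrite conjgE invgK !rhoM => E1; rewrite -{2}E1 -!mulrA; congr (_ * _).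
by rewrite -rhoM mulVg rho1 mulr1.
Qed.

End Nilpotent.
End LoopFiltration.

(** * Reduced words in a free group and unitriangular matrices *)

Section Syllables.
Variable K : groupType.
Implicit Types (z : K) (x : nat -> K) (e : int).

Definition zexp z e : K :=
  match e with Posz k => (z ^+ k)%g | Negz k => (z ^- k.+1)%g end.

Lemma zexp_succ z e : (z * zexp z e)%g = zexp z (e + 1).
Proof.
case: e => [k|[|k]].
- have -> : Posz k + 1 = Posz k.+1 by lia.
  by rewrite /= expgS.
- by rewrite /= mulgV.
have -> : Negz k.+1 + 1 = Negz k by lia.
by rewrite /= (expgSr _ k.+1) invgM mulgA mulgV mul1g.
Qed.

Lemma zexp_pred z e : (z^-1 * zexp z e)%g = zexp z (e - 1).
Proof. by rewrite -{1}(subrK 1 e) -zexp_succ mulKg. Qed.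

Definition syllable_val x (s : seq (nat * int)) : K :=
  (\prod_(p <- s) zexp (x p.1) p.2)%g.

End Syllables.

Definition reduced_syllables (s : seq (nat * int)) : bool :=
  all (fun p => p.2 != 0) s && sorted (fun p q => p.1 != q.1) s.

(** One reduced form serves all groups at once: what is learnt about it in the free group applies to
    the loops in the braid group. *)
Lemma word_syllables M (w : word nat) : all (fun l => l.1 < M)%N w ->
  exists s, [/\ reduced_syllables s, all (fun p => p.1 < M)%N s &
    forall (K : groupType) (x : nat -> K), word_val x w = syllable_val x s].
Proof.
elim: w => [|[i b] w IHw] /=.
  by move=> _; exists [::]; split=> // K x; rewrite /word_val /syllable_val !big_nil.
case/andP=> iM /IHw [s [/andP [s0 s1] sM Es]].
pose d : int := if b then -1 else 1.
have Ed (K : groupType) (z : K) e :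
    ((if b then z^-1 else z) * zexp z e)%g = zexp z (e + d).
  by rewrite /d; case: (b); [apply: zexp_pred|apply: zexp_succ].
have d0 : d != 0 by rewrite /d; case: (b).
have Hcons : (forall p, ohead s = Some p -> p.1 != i) ->
    exists s, [/\ reduced_syllables s, all (fun p => p.1 < M)%N s &
    forall (K : groupType) (x : nat -> K),
      word_val x ((i, b) :: w) = syllable_val x s].
  move=> Hs; exists ((i, d) :: s); split.
  - rewrite /reduced_syllables /= d0 s0 /=.
    by case: s s1 Hs {s0 sM Es} => //= p s -> /(_ p erefl); rewrite eq_sym => ->.
  - by rewrite /= iM.
  move=> K x; rewrite /word_val /syllable_val !big_cons -/(word_val x w) Es /=.
  by have := Ed K (x i) 0; rewrite /= mulg1 add0r => ->.
case: s s0 s1 sM Es Hcons => [|[j e] s] s0 s1 sM Es Hcons; first exact: Hcons.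
have [ji|ji] := eqVneq j i; last by apply: Hcons => _ [<-].
rewrite {j}ji in s0 s1 sM Es {Hcons}.
have Ev (K : groupType) (x : nat -> K) :
    word_val x ((i, b) :: w) = (zexp (x i) (e + d) * syllable_val x s)%g.
  by rewrite /word_val big_cons -/(word_val x w) Es /syllable_val big_cons mulgA /= Ed.
have [ed|ed] := eqVneq (e + d) 0.
  exists s; split; last by move=> K x; rewrite Ev ed /= mul1g.
    case/andP: s0 => _ s0; apply/andP; split; [exact: s0|exact: path_sorted s1].
  by case/andP: sM.
exists ((i, e + d) :: s); split=> [||K x]; last by rewrite Ev /syllable_val big_cons.
  case/andP: s0 => _ s0; apply/andP; split; first by apply/andP; split.
  by case: (s) s1.
exact: sM.
Qed.

Definition free_rel (u v : word nat) : Prop := False.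
Definition free_group : groupType := presented_group free_rel.
Definition free_gen i : free_group := pg_class free_rel [:: (i, false)].

(** * Magnus' representation of the free group *)

Section Magnus.
Variables (d : nat) (c : nat -> nat).
Hypothesis c_neq : forall i, (i.+1 < d)%N -> c i != c i.+1.
Local Notation R := 'M[int]_d.+1.

(** The sum of the elementary matrices [E_(i,i+1)] over the places [i] of colour [b]. Consecutive
    colours differ, so its square is 0 and the [e]-th power of [1 + magnus_mx b] is
    [1 + magnus_mx b *~ e]. *)
Definition magnus_mx (b : nat) : R :=
  \matrix_(i, j) ((j == i.+1 :> nat) && (c i == b))%:R.

Lemma mul_magnus_mx0 (B : R) r b : (B * magnus_mx b) r ord0 = 0.
Proof. by rewrite mxE big1 // => l _; rewrite mxE mulr0. Qed.

Lemma mul_magnus_mxS (B : R) r b j : (j < d)%N ->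
  (B * magnus_mx b) r (inord j.+1) = B r (inord j) *+ (c j == b).
Proof.
move=> jd; have Ej : (inord j : 'I_d.+1) = j :> nat.
  by rewrite inordK // ltnS ltnW.
have Ej1 : (inord j.+1 : 'I_d.+1) = j.+1 :> nat by rewrite inordK.
rewrite mxE (bigD1 (inord j)) //= big1 => [|l lj].
  by rewrite mxE Ej Ej1 eqxx mulr_natr addr0.
rewrite mxE Ej1 eqSS; case: eqP => [E|_]; last by rewrite mulr0.
by case/eqP: lj; apply: val_inj; rewrite /= Ej.
Qed.

Lemma magnus_mx_sq b : magnus_mx b * magnus_mx b = 0.
Proof.
apply/matrixP => i j; rewrite [RHS]mxE.
case: j => -[|j] jd.
  by rewrite (_ : Ordinal jd = ord0) ?mul_magnus_mx0 //; apply: val_inj.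
have Ej : Ordinal jd = inord j.+1 by apply: val_inj; rewrite /= inordK.
rewrite Ej mul_magnus_mxS // mxE inordK 1?ltnW //.
case: eqP => [Ei|_]; last by rewrite mul0rn.
have := @c_neq i; rewrite -Ei => /(_ jd) ne.
by have [<-|_] := eqVneq (c i) b; [rewrite eq_sym (negPf ne)|rewrite mul0rn].
Qed.

Let f b (A : R) : R := A * (1 + magnus_mx b).
Let f' b (A : R) : R := A * (1 - magnus_mx b).

Lemma magnus_mul1 b x y : (1 + magnus_mx b *~ x) * (1 + magnus_mx b *~ y) =
  1 + magnus_mx b *~ (x + y).
Proof.
rewrite mulrDl mul1r mulrDr mulr1 mulrzAl mulrzAr magnus_mx_sq !mul0rz addr0.
by rewrite mulrzDr addrAC addrA.
Qed.

Lemma magnus_fK b : cancel (f b) (f' b).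
Proof.
move=> A; rewrite /f /f' -mulrA -[X in (1 + X) * _]mulr1z -mulrN1z magnus_mul1.
by rewrite subrr mulr0z addr0 mulr1.
Qed.

Lemma magnus_f'K b : cancel (f' b) (f b).
Proof.
move=> A; rewrite /f /f' -mulrA -[X in _ * (1 + X)]mulr1z -mulrN1z magnus_mul1.
by rewrite addNr mulr0z addr0 mulr1.
Qed.

Lemma magnus_rel u v : free_rel u v -> word_act f f' u =1 word_act f f' v.
Proof. by []. Qed.

Definition magnus_rep (q : free_group) : R := pg_act f f' q 1.

Lemma magnus_act q A : pg_act f f' q A = A * magnus_rep q.
Proof.
rewrite /magnus_rep /pg_act; elim/last_ind: (repr q) => [|w [b e] IHw].
  by rewrite /= mulr1.
by rewrite -cats1 !word_act_cat /= IHw; case: e; rewrite /f /f' mulrA.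
Qed.

Lemma magnus_rep1 : magnus_rep 1%g = 1.
Proof. exact: (pg_act1 magnus_fK magnus_f'K magnus_rel). Qed.

Lemma magnus_repM p q : magnus_rep (p * q)%g = magnus_rep p * magnus_rep q.
Proof.
by rewrite /magnus_rep (pg_actM magnus_fK magnus_f'K magnus_rel) magnus_act.
Qed.

Lemma magnus_rep_gen b : magnus_rep (free_gen b) = 1 + magnus_mx b.
Proof.
rewrite /magnus_rep (pg_act_gen magnus_fK magnus_f'K magnus_rel).
exact: mul1r.
Qed.

Lemma magnus_rep_zexp b e :
  magnus_rep (zexp (free_gen b) e) = 1 + magnus_mx b *~ e.
Proof.
have H k : magnus_rep (free_gen b ^+ k)%g = 1 + magnus_mx b *~ k.
  elim: k => [|k IHk]; first by rewrite magnus_rep1 mulr0z addr0.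
  rewrite expgS magnus_repM IHk magnus_rep_gen -{1}(mulr1z (magnus_mx b)).
  by rewrite magnus_mul1 -intS.
case: e => k /=; first exact: H.
have /(congr1 (fun A => (1 + magnus_mx b *~ (Negz k)) * A)) :
    magnus_rep (free_gen b ^+ k.+1)%g * magnus_rep (free_gen b ^- k.+1)%g = 1.
  by rewrite -magnus_repM mulgV magnus_rep1.
rewrite mulr1 mulrA H magnus_mul1 (_ : Negz k + Posz k.+1 = 0) ?mulr0z ?addr0 ?mul1r //.
by rewrite NegzE addNr.
Qed.

Definition upper_band k (A : R) : Prop :=
  forall i j : 'I_d.+1, (j < i + k)%N -> A i j = 0.

Lemma upper_band0 k : upper_band k 0.
Proof. by move=> i j _; rewrite mxE. Qed.

Lemma upper_band1 : upper_band 0 1.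
Proof. by move=> i j; rewrite addn0 mxE => /gtn_eqF ij; rewrite -val_eqE /= ij. Qed.

Lemma upper_bandB k A B : upper_band k A -> upper_band k B -> upper_band k (A - B).
Proof. by move=> HA HB i j ij; rewrite !mxE HA // HB // subr0. Qed.

Lemma upper_bandM k l A B :
  upper_band k A -> upper_band l B -> upper_band (k + l) (A * B).
Proof.
move=> HA HB i j ij; rewrite mxE big1 // => m _.
have [mk|km] := ltnP m (i + k); first by rewrite HA // mul0r.
by rewrite HB ?mulr0 //; lia.
Qed.

Lemma upper_bandW k A : upper_band k.+1 A -> upper_band k A.
Proof. by move=> HA i j ij; apply: HA; lia. Qed.

Lemma upper_band_max A : upper_band d.+1 A -> A = 0.
Proof.
move=> HA; apply/matrixP => i j; rewrite HA ?mxE //.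
by have := ltn_ord j; lia.
Qed.

Lemma upper_band_magnus b : upper_band 1 (magnus_mx b).
Proof. by move=> i j ij; rewrite mxE; case: eqP => // E; lia. Qed.

Lemma upper_band_rep q : upper_band 1 (magnus_rep q - 1).
Proof.
rewrite /magnus_rep /pg_act; elim/last_ind: (repr q) => [|w [b e] IHw].
  by rewrite subrr; apply: upper_band0.
rewrite -cats1 word_act_cat; move: (word_act _ _ w 1) IHw => A HA /=.
have A0 : upper_band 0 A.
  have := upper_bandB (upper_bandW HA) (upper_bandB (@upper_band0 0) (@upper_band1)).
  by rewrite sub0r opprK subrK.
have HX : upper_band 1 (A * magnus_mx b).
  exact: upper_bandM A0 (@upper_band_magnus b).
case: e; rewrite /f /f' ?mulrBr ?mulrDr mulr1 addrAC; first exact: upper_bandB.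
rewrite -(opprK (A * _)) -(sub0r (A * _)).
by apply: upper_bandB => //; apply: upper_bandB => //; apply: upper_band0.
Qed.

Definition row_support (A : R) r p : Prop :=
  forall j, (p < j <= d)%N -> A r (inord j) = 0.

Lemma mul_magnus_zexp (A : R) r b e j : (j < d)%N ->
  (A * magnus_rep (zexp (free_gen b) e)) r (inord j.+1) =
  A r (inord j.+1) + A r (inord j) *+ (c j == b) *~ e.
Proof.
move=> jd; rewrite magnus_rep_zexp mulrDr mulr1 mulrzAr mxE; congr (_ + _).
rewrite -mul_magnus_mxS //; case: e => k; first by rewrite -!pmulrn mulmxnE.
by rewrite NegzE !mulrNz -!pmulrn mxE mulmxnE.
Qed.

Lemma row_support_syllable A r p b e : row_support A r p ->
  row_support (A * magnus_rep (zexp (free_gen b) e)) r p.+1.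
Proof.
move=> HA [|j] // /andP [pj jd]; rewrite mul_magnus_zexp //.
by rewrite !HA ?mul0rn ?mul0rz ?addr0 //; lia.
Qed.

Lemma row_support_syllables A r p s : row_support A r p ->
  row_support (A * magnus_rep (syllable_val free_gen s)) r (p + size s).
Proof.
rewrite /syllable_val; elim: s A p => [|[b e] s IHs] A p HA.
  by rewrite big_nil magnus_rep1 mulr1 addn0.
rewrite big_cons magnus_repM mulrA /= addnS -addSn; apply: IHs.
exact: row_support_syllable.
Qed.

(** When the colours spell the syllables, each syllable moves the last nonzero entry of row [r] one
    column to the right and multiplies it by its exponent, a nonzero integer. *)
Lemma row_lead_syllables (A : R) r p s : (p + size s <= d)%N ->
  (forall i, (i < size s)%N -> c (p + i) = (nth (0%N, 0) s i).1) ->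
  all (fun q => q.2 != 0) s -> row_support A r p -> A r (inord p) != 0 ->
  (A * magnus_rep (syllable_val free_gen s)) r (inord (p + size s)) != 0.
Proof.
rewrite /syllable_val; elim: s A p => [|[b e] s IHs] A p psd Hc.
  by rewrite big_nil magnus_rep1 mulr1 addn0.
rewrite /= => /andP [e0 s0] HA Ap; rewrite /= in psd.
rewrite big_cons magnus_repM mulrA addnS -addSn; apply: IHs => //.
- by rewrite addSnnS.
- by move=> i il; rewrite addSnnS; apply: (Hc i.+1).
- exact: row_support_syllable.
rewrite mul_magnus_zexp; last lia.
rewrite HA ?add0r; last lia.
have := Hc 0%N isT; rewrite addn0 /= => ->; rewrite eqxx mulr1n.
by rewrite -mulrzr mulf_eq0 negb_or Ap intz.
Qed.

End Magnus.

(** The colours spell the word followed by one more generator [a]. In the corner entry [(0, k+1)],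
    the word times [magnus_mx a] gives the product of the exponents, while [magnus_mx a] times the
    word gives 0. *)
Lemma magnus_noncommuting M s : (1 < M)%N -> s != [::] ->
  reduced_syllables s -> all (fun p => p.1 < M)%N s ->
  exists a d c, [/\ (a < M)%N, forall i, (i.+1 < d)%N -> c i != c i.+1 &
    magnus_rep d c (syllable_val free_gen s) * magnus_rep d c (free_gen a) <>
    magnus_rep d c (free_gen a) * magnus_rep d c (syllable_val free_gen s)].
Proof.
case: s => // p0 s M1 _ /andP [s0 s1] sM.
set S := p0 :: s; set k := size S.
(* A second generator is available because [1 < M]; differing from the last letter keeps consecutive
   colours distinct. *)
have [a aM alast] : exists2 a, (a < M)%N & a != (last p0 s).1.
  have [E|ne] := eqVneq 0%N (last p0 s).1; last by exists 0%N => //; lia.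
  by exists 1%N => //; rewrite -E.
pose c i := if (i < k)%N then (nth (0%N, 0) S i).1 else a.
have c_neq i : (i.+1 < k.+1)%N -> c i != c i.+1.
  rewrite ltnS => ik; rewrite /c ik; case: ltnP => [ik1|ki1].
    by move/(sortedP (0%N, 0)): s1 => /(_ i ik1).
  have Ei : i = (size s) by move: ik ki1; rewrite /k /=; lia.
  rewrite Ei -[size s]/((size S).-1) nth_last eq_sym /=; exact: alast.
exists a, k.+1, c; split=> //; set U := magnus_rep _ _ _.
rewrite (magnus_rep_gen c_neq) mulrDr mulrDl mulr1 mul1r => /addrI.
move/matrixP/(_ ord0 (inord k.+1)).
rewrite mul_magnus_mxS // /c ltnn eqxx mulr1n mxE big1 => [/eqP|l _].
  apply/negP; have -> : U = 1 * U by rewrite mul1r.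
  apply: (row_lead_syllables c_neq (p := 0%N)) => //.
  - by move=> i iS; rewrite add0n /c iS.
  - move=> j /andP [j0 jk]; rewrite mxE; case: eqP => // E.
    by move: j0; rewrite -(inordK (m := j) (n' := k.+1)) // -E.
  by rewrite mxE (_ : inord 0 = ord0) ?eqxx //; apply: val_inj; rewrite /= inordK.
rewrite mxE; case: eqP => [El|_]; last by rewrite mul0r.
have [Ea|_] := eqVneq (c (@ord0 k.+1)) a; last by rewrite mul0r.
rewrite mul1r; have <- : inord 1 = l by apply: val_inj; rewrite /= inordK // El.
(* Row 1 of the word: the first syllable has colour [c 0], different from [c 1], and moves nothing.
   The [k - 1] other syllables reach column [k] at most. *)
have -> : U = 1 * magnus_rep k.+1 c (zexp (free_gen p0.1) p0.2) *
    magnus_rep k.+1 c (syllable_val free_gen s).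
  by rewrite mul1r -magnus_repM // /U /syllable_val big_cons.
apply: (row_support_syllables c_neq (p := 1%N)) => //; last by rewrite /k /=; lia.
case=> [|j] // /andP [j1 jk]; rewrite mul_magnus_zexp //.
have ne1 : (inord 1 : 'I_k.+2) == inord j.+1 = false.
  by apply/negbTE; rewrite -val_eqE /= !inordK //; lia.
rewrite !mxE ne1 add0r -val_eqE /= !inordK ?ltnS //; last lia.
have [Ej|_] := eqVneq 1%N j; last by rewrite mul0rn mul0rz.
rewrite -Ej; have := c_neq 0%N isT; rewrite [c 0%N]/c /= eq_sym => /negPf ->.
by rewrite mulr0n mul0rz.
Qed.

Local Open Scope group_scope.

(** * Detecting the elements of the sphere braid group *)

Lemma pushes_free M (g : sphere_braid_group M.+2) : pushes g ->
  exists2 w : word nat, all (fun l => l.1 < M)%N w &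
    g = word_val (push_gen M) w.
Proof.
case=> w + ->; elim: w => [|[j b] w IHw] /=.
  by move=> _; exists [::]; rewrite // /word_val !big_nil.
case/andP=> jM /IHw [u Hu Eu].
suff [u' Hu' Eu'] : exists2 u' : word nat, all (fun l => l.1 < M)%N u' &
    (if b then (push_gen M j)^-1 else push_gen M j) = word_val (push_gen M) u'.
  exists (u' ++ u); first by rewrite all_cat Hu'.
  by rewrite word_val_cat -Eu' -Eu /word_val big_cons.
have [jlt|] := ltnP j M.
  by exists [:: (j, b)]; rewrite /= ?jlt // /word_val big_seq1.
move=> Mj; have {jM Mj} -> : j = M by apply/eqP; rewrite eqn_leq jM.
pose u' := gen_word (iota 0 M).
have Hu' : all (fun l => l.1 < M)%N u'.
  by apply/allP => l /mapP [i]; rewrite mem_iota add0n => /andP [_ iM] ->.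
have E : word_val (push_gen M) u' * push_gen M M = 1.
  have := push_gen_prod M; rewrite word_val_gen.
  have -> : iota 0 M.+1 = iota 0 M ++ [:: M] by rewrite -addn1 iotaD.
  by rewrite big_cat big_seq1.
case: b.
  by exists u' => //; rewrite -(mulg1_eq E) invgK.
exists (inv_word u'); first by rewrite /inv_word all_rev all_map.
by rewrite word_val_inv (mulg1_eq E).
Qed.

(** The generic loop system: [M] free generators, with the last entry forced by the product
    condition. *)
Definition free_loop M i : free_group :=
  if (i < M)%N then free_gen i
  else if i == M then (prefix_prod free_gen M)^-1 else 1.

Lemma free_loopP M : loop_system M (free_loop M).
Proof.
apply/asboolP; split=> [|i Mi].
  rewrite /= (@eq_prefix_prod _ _ free_gen) => [|i iM]; last by rewrite /free_loop iM.
  by rewrite /free_loop ltnn eqxx mulgV.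
by rewrite /free_loop ltnNge ltnW //= gtn_eqF.
Qed.

Definition free_loops M : loops M free_group :=
  exist (@loop_system M free_group) (free_loop M) (free_loopP M).

Lemma word_val_free_loop M w : all (fun l => l.1 < M)%N w ->
  word_val (free_loop M) w = word_val free_gen w.
Proof.
move=> Hw; apply: eq_big_seq => l /(allP Hw) lM.
by rewrite /free_loop lM.
Qed.

(** A nonempty reduced form would fail to commute in some Magnus representation; hence the reduced
    form is empty and the word has value 1 in every group. *)
Lemma commuting_pushes_eq1 M w : (1 < M)%N -> all (fun l => l.1 < M)%N w ->
  (forall a d c, (a < M)%N -> (forall i, (i.+1 < d)%N -> c i != c i.+1) ->
    magnus_rep d c (word_val free_gen w) * magnus_rep d c (free_gen a) =
    magnus_rep d c (free_gen a) * magnus_rep d c (word_val free_gen w))%R ->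
  word_val (push_gen M) w = 1.
Proof.
move=> M1 /word_syllables [s [s_red sM Es]]; rewrite !Es => H.
case: (eqVneq s [::]) => [->|s0]; first by rewrite /syllable_val big_nil.
have [a [d [c [aM c_neq []]]]] := magnus_noncommuting M1 s0 s_red sM.
exact: H.
Qed.

Lemma undetected_pushes_eq1 M (g : sphere_braid_group M.+2) :
  (1 < M)%N -> pushes g -> undetected g -> g = 1.
Proof.
move=> M1 /pushes_free [w Hw ->] Hg; apply: commuting_pushes_eq1 => // a d c aM c_neq.
have Hw' : all (fun l => l.1 <= M)%N w by apply: sub_all Hw => l; apply: ltnW.
have := @undetected_pushes_commute M free_group _ (magnus_rep d c)
  (magnus_rep1 c_neq) (magnus_repM c_neq) (@upper_band d) d.+1
  (@upper_band0 d) (@upper_band1 d) (@upper_band_rep d c) (@upper_bandB d)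
  (@upper_bandM d) (@upper_bandW d) (@upper_band_max d) w (free_loops M) a Hw' Hg.
by rewrite [val _]/= word_val_free_loop // /free_loop aM.
Qed.

(** The counterpart for an element known to fix all free loop systems; it serves for the square of
    the full twist. *)
Lemma loop_trivial_pushes_eq1 M (g : sphere_braid_group M.+2) :
  (1 < M)%N -> pushes g ->
  (forall y : loops M free_group,
     sb_act (@loops_s M _) (@loops_s' M _) (@loops_a M _) (@loops_a' M _) g
       (M.+1, y) = (M.+1, y)) ->
  g = 1.
Proof.
move=> M1 /pushes_free [w Hw ->] Hg; apply: commuting_pushes_eq1 => // a d c aM c_neq.
have Hw' : all (fun l => l.1 <= M)%N w by apply: sub_all Hw => l; apply: ltnW.
have := Hg (free_loops M); rewrite (sb_act_pushes (loops_system M _)) // => -[].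
move/(congr1 val); rewrite val_word_act_loops word_act_conj_by => /(congr1 (@^~ a)).
rewrite [val _]/= word_val_free_loop // /conj_all /free_loop aM conjgE invgK => E.
rewrite -!magnus_repM // -{2}E; congr magnus_rep.
by rewrite mulgA mulgVK.
Qed.

Lemma gr_elt_inj (G : groupType) : injective (@gr_elt G).
Proof.
move=> g h /(congr1 (gr_extend (fun k => (k == h)%:Z))); rewrite !gr_extend_elt eqxx.
by case: eqP.
Qed.

(** With two strands the sphere relation makes the generator its own inverse, so W = 0. *)
Lemma undetected2 (g : sphere_braid_group 2) : undetected g -> g = 1.
Proof.
move=> /(_ 1%N) Hg; apply: gr_elt_inj; apply/eqP; rewrite gr_elt1 -GRing.subr_eq0.
apply/eqP; suff H x : singular_ideal 2 x -> x = 0%R.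
  move: Hg; apply: (@ideal_mul_ind _ _ _ (fun x => x = 0%R)) => [|x y _ /H ->];
    last by rewrite mulr0.
  by split=> // x y -> ->; rewrite subr0.
move=> Hx; pose Z (y : group_ring (sphere_braid_group 2)) := y = 0%R.
suff: Z x by []; apply: Hx; split; first split.
- by split=> // y z; rewrite /Z => -> ->; rewrite subr0.
- by move=> a y; rewrite /Z => ->; rewrite mulr0 mul0r.
move=> _ [i ->]; have := sg_sphere 2; rewrite /= !big_seq1 => s2.
by rewrite /Z -sgE (_ : nat_of_ord i = 0%N) ?(mulg1_eq s2) ?subrr //; case: (i) => -[].
Qed.

(** * Three strands *)

Section ThreeStrands.
Local Notation a := (sg 3 0).
Local Notation b := (sg 3 1).

(** The relation [a b b a = 1] gives [a^2 b^2 = 1], so [a^2] commutes with [a] and [b]. As [a] and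
    [b] are conjugate, the central elements [a^2] and [b^2] coincide. *)
Lemma sg3_sq : (a * a) * (b * b) = 1 /\ (b * b) * (b * b) = 1.
Proof.
have aba : a * (b * a) = b * (a * b) by apply: (@sg_near 3 0).
have H : a * (b * (b * a)) = 1.
  by have := sg_sphere 3; rewrite /= /rev /= !big_cons !big_nil !mulg1 -!mulgA.
have H' : a * (b * b) * a = 1 by rewrite -H !mulgA.
have Haabb : (a * a) * (b * b) = 1.
  by rewrite -mulgA -[a * (b * b)]invgK (mulg1_eq H') mulgV.
have ab : a ^ (a * b)^-1 = b by rewrite conjgE invgK -!mulgA !mulgA -(mulgA a) aba !gnorm.
have Hbb : (a * a)^-1 = b * b by apply: mulg1_eq.
have Ebb : b * b = a * a.
  rewrite -[in LHS]ab -conjMg; apply/conjg_fixP/commgP; apply: commuteV.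
  apply: commuteM; first by apply/commute_sym; apply: commuteM.
  apply: commute_sym; rewrite -(invgK (a * a)); apply: commuteV.
  by rewrite Hbb; apply: commuteM.
by split=> //; rewrite {1}Ebb.
Qed.

Lemma push_gen3 j : (j <= 1)%N -> push_gen 1 j = b * b.
Proof.
have E1 : push_gen 1 1 = b * b by rewrite /push_gen last_to_max invg1 conjg1.
case: j => [|[|]] // _.
have := push_gen_prod 1; rewrite /= !big_cons big_nil mulg1 E1 => E0.
by rewrite -[LHS]invgK (mulg1_eq E0) (mulg1_eq (proj2 sg3_sq)).
Qed.

Let rot (_ : nat) (x : bool * bool) := (x.1 (+) x.2, ~~ x.2).
Let rot' (_ : nat) (x : bool * bool) := (x.1 (+) ~~ x.2, ~~ x.2).
Let f (i : 'I_2) := rot i.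
Let f' (i : 'I_2) := rot' i.

Let fK i : cancel (f i) (f' i). Proof. by move=> [[] []]. Qed.
Let f'K i : cancel (f' i) (f i). Proof. by move=> [[] []]. Qed.
Let frel u v : @sphere_braid_rel 3 u v -> word_act f f' u =1 word_act f f' v.
Proof. by apply: (@sphere_rel_act 1) => // -[[] []]. Qed.

(* Elements of Z/4 are written in binary; rot adds 1. *)
Let act := @pg_act _ (@sphere_braid_rel 3) _ f f'.

Let act_sq i x : (i < 2)%N -> act (sg 3 i * sg 3 i) x = (~~ x.1, x.2).
Proof.
move=> i2; rewrite (sgE (Ordinal (i2 : (i < 3.-1)%N))) /act (pg_actM fK f'K frel).
by rewrite !(pg_act_gen fK f'K frel); case: x => [[] []].
Qed.

Lemma sg3_sq_neq1 i : (i < 2)%N -> sg 3 i * sg 3 i <> 1.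
Proof.
move=> i2 /(congr1 (fun g => act g (false, false))).
by rewrite act_sq // /act (pg_act1 fK f'K frel).
Qed.

(** Functions from Z/4 to the field with two elements: degree 1 means invariance under adding 2, and
    degree 2 means being 0. The difference [h (x + 1) - h (x - 1)] gains a degree in characteristic
    2, but [b^2] adds 2 and moves the indicator of 0. *)
Lemma undetected3_sq : ~ undetected (b * b).
Proof.
move=> Hg.
pose E k (h : bool * bool -> 'F_2) :=
  [/\ (0 < k)%N -> forall x, h (~~ x.1, x.2) = h x & (1 < k)%N -> forall x, h x = 0%R].
have char2 (u v : 'F_2) : (u - v = v - u)%R.
  by apply/val_inj; case: u v => [[|[]] //= ?] [[|[]] //= ?].
pose flip (x : bool * bool) := (~~ x.1, x.2).
have ff c x : f c (flip x) = flip (f c x) by case: x => [[] []].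
have ff' c x : f' c x = flip (f c x) by case: x => [[] []].
have flipK x : flip (flip x) = x by case: x => [[] []].
have E0 k : E k (fun=> 0%R) by [].
have EB k h h' : E k h -> E k h' -> E k (fun x => h x - h' x)%R.
  move=> [H1 H2] [H1' H2']; split=> [k0|k1] x; first by rewrite H1 // H1'.
  by rewrite H2 // H2' // subr0.
have Ef k h c : E k h -> E k (h \o f c).
  move=> [H1 H2]; split=> [k0|k1] x /=; last exact: H2.
  by rewrite [(_, _)]/(flip x) ff; apply: H1.
have Ef' k h c : E k h -> E k (h \o f' c).
  move=> [H1 H2]; split=> [k0|k1] x /=; last exact: H2.
  by rewrite [(_, _)]/(flip x) !ff' ff; apply: H1.
have Ed k h c : E k h -> E k.+1 (fun x => h (f c x) - h (f' c x))%R.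
  move=> [H1 H2]; split=> [_|k0] x.
    by rewrite [(_, _)]/(flip x) !ff' ff flipK char2.
  by rewrite ff' H1 // subrr.
have E_all h : E 0%N h by [].
have [_] := @undetected_act 3 _ f f' fK f'K frel _ E E0 EB Ef Ef' Ed _ 0%N _ Hg
  (E_all (fun x => (x == (false, false))%:R)%R) 2.
move=> /(_ isT (false, false)) /eqP.
by rewrite -[pg_act _ _ _ _]/(act _ _) act_sq.
Qed.

End ThreeStrands.

Lemma pushes3 (g : sphere_braid_group 3) :
  @pushes 1 g -> g = 1 \/ g = sg 3 1 * sg 3 1.
Proof.
case=> w + ->; rewrite /word_val; elim: w => [|[j c] w IHw] /=.
  by rewrite big_nil; left.
case/andP=> j1 /IHw {}IHw; rewrite big_cons /= push_gen3 //.
have Hbb := proj2 sg3_sq; have -> : (sg 3 1 * sg 3 1)^-1 = sg 3 1 * sg 3 1.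
  exact: mulg1_eq.
by rewrite if_same; case: IHw => ->; [right; rewrite mulg1|left].
Qed.

Lemma undetected_eq1 M (g : sphere_braid_group M.+2) : undetected g -> g = 1.
Proof.
elim: M g => [|M IHM] g Hg; first exact: undetected2.
have [y Ey Hy] := undetected_removal Hg.
have Pg : pushes g by apply: pushes_removal; exists y; split=> //; apply: IHM.
case: M {IHM y Ey Hy} g Hg Pg => [|M] g Hg Pg; last exact: undetected_pushes_eq1.
by case: (pushes3 Pg) Hg => // -> /undetected3_sq.
Qed.

(** * The full twist *)

(* The full twist is the product of the pure braids
   sigma_k ... sigma_1 sigma_1 ... sigma_k; on the sphere the last factor is
   trivial and is omitted. *)
Definition twist_seq l : seq nat :=
  flatten [seq rev (iota 0 k.+1) ++ iota 0 k.+1 | k <- iota 0 l].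

Definition twist n : sphere_braid_group n := \prod_(i <- twist_seq n.-2) sg n i.

Lemma twist_seqS l :
  twist_seq l.+1 = twist_seq l ++ rev (iota 0 l.+1) ++ iota 0 l.+1.
Proof. by rewrite /twist_seq -{1}addn1 iotaD map_cat flatten_cat /= cats0. Qed.

Lemma twist_seq_lt l i : i \in twist_seq l -> (i < l)%N.
Proof.
elim: l => // l IHl; rewrite twist_seqS !mem_cat mem_rev mem_iota.
by case/or3P=> [/IHl|/andP []|/andP []] //; lia.
Qed.

Lemma sb_act_prod M X s s' a a' (D : @marked_system M X s s' a a') t x :
  all (fun k => k < M)%N t ->
  sb_act s s' a a' (\prod_(k <- t) sg M.+2 k) (M.+1, x) =
  (M.+1, foldl (fun y k => s k y) x t).
Proof.
elim: t x => [|k t IHt] x /=; first by rewrite big_nil (sb_act1 D).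
case/andP=> kM /IHt {}IHt; rewrite big_cons (sb_actM D) (sb_act_sg D) 1?ltnW //.
by rewrite marked_act_hi ?IHt // !ltnS kM leqnn.
Qed.

(** In the inductive step the sweep down brings the new entry to the front and conjugates the others
    by it. The sweep up returns it to its place, conjugated by the whole product. *)
Lemma fold_hurwitz_twist (Q : groupType) l (y : nat -> Q) :
  foldl (fun y k => hurwitz k y) y (twist_seq l) =
  fun i => if (i <= l)%N then y i ^ prefix_prod y l.+1 else y i.
Proof.
elim: l => [|l IHl].
  by apply/funext => -[|i] //=; rewrite mul1g conjgE mulKg.
rewrite twist_seqS !foldl_cat IHl.
set y1 := fun i => if (i <= l)%N then _ else _.
pose y2 i := if i == 0%N then y1 l.+1 else
  if (i <= l.+1)%N then y1 i.-1 ^ y1 l.+1 else y1 i.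
rewrite fold_hurwitz_down -/y2 fold_hurwitz_up.
have y1l : y1 l.+1 = y l.+1 by rewrite /y1 ltnn.
have P1 : prefix_prod y1 l.+2 = prefix_prod y l.+2.
  rewrite -[LHS]/(prefix_prod y1 l.+1 * y1 l.+1) y1l.
  rewrite (@eq_prefix_prod _ _ (conj_all (prefix_prod y l.+1) y)) => [|i il].
    by rewrite prefix_prod_conj_all conjgE mulKg.
  by rewrite /y1 -ltnS il.
have P2 : prefix_prod y2 l.+2 = prefix_prod y l.+2.
  have -> : y2 = foldl (fun y k => hurwitz k y) y1 (rev (iota 0 l.+1)).
    by rewrite fold_hurwitz_down.
  rewrite -P1; have: all (fun k => k.+1 < l.+2)%N (rev (iota 0 l.+1)).
    by rewrite all_rev; apply/allP => i; rewrite mem_iota.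
  elim: (rev _) (y1) => // k t IHt z /andP [kl /IHt {}IHt].
  by apply: etrans (IHt _) (prefix_prod_hurwitz _ kl).
apply/funext => i; rewrite P2.
have [il|li] := ltnP i l.+1.
  by rewrite leqW // /y2 /= il y1l /y1 -ltnS il -conjgM.
have [->|ne] := eqVneq i l.+1; first by rewrite leqnn /y2 eqxx y1l.
have -> : (i <= l.+1)%N = false by apply/negbTE; lia.
have -> : y2 i = y1 i.
  rewrite /y2; case: i li ne => // i li ne.
  by have -> : (i < l.+1)%N = false by apply/negbTE; lia.
by rewrite /y1; have -> : (i <= l)%N = false by apply/negbTE; lia.
Qed.

(** The last palindrome in the word of the twist becomes trivial with one strand less, by the sphere
    relation; what remains is the twist there. *)
Lemma twist_removal M x :
  sb_act (fun k (x : sphere_braid_group M.+1) => x * sg M.+1 k)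
    (fun k x => x / sg M.+1 k) (fun _ => id) (fun _ => id) (twist M.+2) (M.+1, x) =
  (M.+1, x * twist M.+1).
Proof.
rewrite /twist (sb_act_prod (removal_system M)); last first.
  by apply/allP => i /twist_seq_lt.
congr pair; have foldP t z : foldl (fun y k => y * sg M.+1 k) z t =
    z * \prod_(k <- t) sg M.+1 k.
  by elim: t z => [|k t IHt] z; rewrite ?big_nil ?mulg1 //= big_cons IHt mulgA.
rewrite foldP; congr (_ * _); case: M {x foldP} => [|M]; first by rewrite /twist_seq big_nil.
rewrite [M.+3.-2]/= twist_seqS !big_cat /= -[RHS]mulg1; congr (_ * _).
have := sg_sphere M.+2; set P := \prod_(i <- iota _ _) _ => /mulg1_eq <-.
by rewrite mulVg.
Qed.

Lemma twist_neq1 M : twist M.+3 <> 1.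
Proof.
elim: M => [|M IHM].
  rewrite /twist /twist_seq /= !big_cons big_nil mulg1.
  exact: (@sg3_sq_neq1 0).
move=> E1; have := @twist_removal M.+2 1.
by rewrite E1 (sb_act1 (removal_system _)) mul1g => -[/esym].
Qed.

(** By induction the square is a product of loops. The twist conjugates a loop system by its total
    product, which is 1, so it acts trivially and faithfulness on such products applies. *)
Lemma twist_sq M : twist M.+3 * twist M.+3 = 1.
Proof.
elim: M => [|M IHM].
  have [H1 H2] := sg3_sq; rewrite /twist /twist_seq /= !big_cons big_nil mulg1.
  have -> : sg 3 0 * sg 3 0 = sg 3 1 * sg 3 1 by rewrite -(mulg1_eq H2) -(mulg1_eq H1) invgK.
  exact: H2.
have D := removal_system M.+2; have D' := loops_system M.+2 free_group.
apply: (@loop_trivial_pushes_eq1 M.+2) => // [|y].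
  apply: pushes_removal; exists 1; split=> //.
  by rewrite (sb_actM D) !twist_removal mul1g IHM.
have H x : sb_act (@loops_s M.+2 free_group) (@loops_s' M.+2 free_group)
    (@loops_a M.+2 free_group) (@loops_a' M.+2 free_group) (twist M.+4) (M.+3, x) = (M.+3, x).
  rewrite (sb_act_prod D'); last by apply/allP => i /twist_seq_lt.
  congr pair; apply: val_inj; rewrite val_fold_loops_s; last first.
    by apply/allP => i /twist_seq_lt.
  rewrite fold_hurwitz_twist loops_prod; apply/funext => i.
  by rewrite conjg1 if_same.
by rewrite (sb_actM D') !H.
Qed.

Lemma singular_mod1M n (g h : sphere_braid_group n) :
  singular_ideal n (gr_elt g - 1)%R -> singular_ideal n (gr_elt h - 1)%R ->
  singular_ideal n (gr_elt (g * h) - 1)%R.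
Proof.
have HI := singular_ideal_ideal n.
move=> Hg Hh; rewrite gr_eltM.
have := additive_subgroupD HI.1 (HI.2 (gr_elt h) _ Hg).2 Hh.
by rewrite mulrBl mul1r addrA subrK.
Qed.

Lemma twist_singular n : singular_ideal n (gr_elt (twist n) - 1)%R.
Proof.
have HI := singular_ideal_ideal n.
have H1 : singular_ideal n (gr_elt (1 : sphere_braid_group n) - 1)%R.
  by rewrite gr_elt1 subrr; apply: HI.1.1.
(* Each square is 1 modulo W, since [s^2 - 1 = (s - s^-1) s]; a palindrome therefore collapses from
   its middle. *)
have Hpal t : (forall i, i \in t -> (i < n.-1)%N) -> singular_ideal n
    (gr_elt (\prod_(i <- rev t ++ t) sg n i) - 1)%R.
  elim: t => [|i t IHt] Ht; first by rewrite big_nil.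
  have {}IHt : singular_ideal n (gr_elt (\prod_(i <- rev t ++ t) sg n i) - 1)%R.
    by apply: IHt => j jt; apply: Ht; rewrite inE jt orbT.
  rewrite big_cat /= in IHt; rewrite rev_cons cat_rcons big_cat /= !big_cons.
  set x := \prod_(i <- rev t) _ in IHt *; set y := \prod_(i <- t) _ in IHt *.
  set s := sg n i.
  have Hs : singular_ideal n (gr_elt s * gr_elt s - 1)%R.
    have := (HI.2 (gr_elt s) _ (singular_ideal_sg (Ht i (mem_head _ _)))).2.
    by rewrite mulrBl -!gr_eltM mulVg.
  have := additive_subgroupD HI.1
    (HI.2 (gr_elt y) _ (HI.2 (gr_elt x) _ Hs).1).2 IHt.
  by rewrite mulrBr mulr1 mulrBl -!gr_eltM addrA subrK !mulgA.
rewrite /twist; have: (n.-2 <= n.-2)%N by [].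
elim: {1 3}n.-2 => [|l IHl] ln; first by rewrite big_nil.
rewrite twist_seqS big_cat; apply: singular_mod1M; first by apply: IHl; apply: ltnW.
by apply: Hpal => i; rewrite mem_iota; lia.
Qed.

(** For [x = t - 1] with [t^2 = 1] one has [x^2 = - 2 x], so each further factor [x] in W yields
    another factor 2. *)
Lemma twist_filtration M m :
  @vassiliev_filtration M.+3 m.+1 ((gr_elt (twist M.+3) - 1) *+ 2 ^ m)%R.
Proof.
have HI := singular_ideal_ideal M.+3; have HW := @twist_singular M.+3.
set x := (gr_elt _ - 1)%R in HW *.
have Hx : (x * x = - (x *+ 2))%R.
  rewrite {1}/x mulrBl mul1r {1}/x mulrBr mulr1 -gr_eltM twist_sq gr_elt1.
  by rewrite -/x -[in LHS](opprB (gr_elt _)) -/x -opprD mulr2n.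
elim: m => [|m IHm].
  by rewrite expn0 mulr1n -(mul1r x); apply: mem_ideal_mul.
have := additive_subgroupN (@vassiliev_filtration_ideal M.+3 m.+2).1
  (mem_ideal_mul IHm HW).
by rewrite mulrnAl Hx mulNrn opprK -mulrnA expnS.
Qed.

(** * Invariants from quotients of the group ring *)

Lemma quotient_by_subgroup (R : nzRingType) (I : set R) : additive_subgroup I ->
  exists (A : zmodType) (f : R -> A),
    {morph f : x y / (x - y)%R} /\ (forall x y, f x = f y <-> I (x - y)%R).
Proof.
move=> HI; pose S : {pred R} := fun x => `[< I x >].
have S_closed : zmod_closed S.
  split; first by apply/asboolP; exact: HI.1.
  by move=> x y /asboolP Ix /asboolP Iy; apply/asboolP; apply: HI.2.
pose Sz : zmodClosed R := HB.pack S (GRing.isZmodClosed.Build R S S_closed).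
exists (Quotient.quot Sz), (\pi_(Quotient.quot Sz))%qT; split.
  exact: GRing.raddfB.
move=> x y; have E := Quotient.idealrBE Sz x y.
split=> [xy|Ixy]; first by apply/asboolP; rewrite -[asbool _]/((x - y)%R \in Sz) E xy.
by apply/eqP; rewrite -E; apply/asboolP.
Qed.

Lemma gr_extend_gr_elt (G : groupType) (x : group_ring G) :
  gr_extend (@gr_elt G) x = x.
Proof.
elim/gr_ind: x => [|x y IHx IHy|c g]; first exact: gr_extend0.
  by rewrite gr_extendD IHx IHy.
rewrite gr_extendU /gr_elt; case: c => k.
  by rewrite -pmulrn -monalgUMn natz.
by rewrite NegzE mulrNz -pmulrn -monalgUMn -monalgUN natz.
Qed.

(** If [a - b] lay in every power of W, multiplying by [b^-1] on the right would make [a b^-1]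
    undetected, hence trivial. *)
Lemma separating_degree M (a b : sphere_braid_group M.+2) : a <> b ->
  exists m, ~ @vassiliev_filtration M.+2 m.+1 (gr_elt a - gr_elt b)%R.
Proof.
move=> ab; apply: contrapT => Hm; apply: ab; apply: divg1_eq.
apply: undetected_eq1 => m.
have HW := @vassiliev_filtration_ideal M.+2 m.
have Hab : @vassiliev_filtration M.+2 m (gr_elt a - gr_elt b)%R.
  apply: (@ideal_pow_le _ _ m.+1) => //; first exact: singular_ideal_ideal.
  by apply: contrapT => H; apply: Hm; exists m.
have := (HW.2 (gr_elt b^-1) _ Hab).2.
by rewrite mulrBl -!gr_eltM mulgV gr_elt1.
Qed.

Theorem corollary4p2 (n : nat) (hn : (3 <= n)%N) :
  (exists a b : sphere_braid_group n, a <> b /\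
     forall (A : zmodType) (v : sphere_braid_group n -> A),
       no_2_torsion A -> vassiliev_invariant v -> v a = v b) /\
  (forall a b : sphere_braid_group n, a <> b ->
     exists (k : nat) (A : zmodType) (v : sphere_braid_group n -> A),
       [/\ (0 < k)%N,
           exists x : A, has_additive_order x (2 ^ k)%N,
           vassiliev_invariant v
         & v a <> v b]).
Proof.
case: n hn => [|[|[|M]]] // _; split.
  exists (twist M.+3), 1; split; first exact: twist_neq1.
  move=> A v A2 [m Hv]; apply/eqP; rewrite -GRing.subr_eq0; apply/eqP.
  have := Hv _ (@twist_filtration M m).
  have -> k : gr_extend v ((gr_elt (twist M.+3) - 1) *+ k)%R =
      ((v (twist M.+3) - v 1%g) *+ k)%R.
    elim: k => [|k IHk]; first exact: gr_extend0.
    by rewrite !mulrS gr_extendD IHk gr_extendB -gr_elt1 !gr_extend_elt.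
  (* The value difference is killed by [2 ^ m]; the factors 2 are cancelled one at a time. *)
  elim: m {Hv} => [|m IHm]; first by rewrite expn0 mulr1n.
  by rewrite expnSr mulrnA => /A2 /IHm.
move=> a b /separating_degree [m Hm].
have [A [f [fB fP]]] := quotient_by_subgroup (@vassiliev_filtration_ideal M.+3 m.+1).1.
(* The quotient by W^(m+1) separates the two elements. The factor Z/2, on which the invariant is 0,
   supplies an element of order 2. *)
exists 1%N, (A * 'Z_2)%type, (fun g => (f (gr_elt g), 0%R)); split=> //.
- exists (0, 1)%R; split=> // [|e e0 /(congr1 snd)].
    by rewrite expn1 mulr2n; congr pair; [exact: addr0|apply/val_inj].
  by case: e e0 => [|[|e]].
- exists m => x Hx.
  have F : {morph (fun x => (f x, 0) : A * 'Z_2) : x y / x - y}%R.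
    by move=> y z; rewrite fB; congr pair; rewrite subr0.
  have := gr_extend_additive (@gr_elt (sphere_braid_group M.+3)) x F.
  rewrite gr_extend_gr_elt /comp => <-; have f0 : f 0%R = 0%R.
    by have := fB 0%R 0%R; rewrite !subrr.
  by congr pair; rewrite -f0; apply/fP; rewrite subr0.
by move/(congr1 fst)/fP.
Qed.
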